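(* Let $f$ be a convex function with domain $\mathrm{dom}(f)\subseteq\mathbb{R}^d$ that is self-concordant (see context), with minimizer $x_*$. Let $\{x_k\}_{k\ge0}$ be the iterates generated by the convex Broyden class of quasi-Newton methods (see context) with parameters $\phi_k\in[0,1]$, initial point $x_0\in\mathrm{dom}(f)$ and initial symmetric positive-definite Hessian approximation $B_0$. Suppose $$\|\nabla^{2}f(x_* )^\frac{1}{2}(x_0 - x_* )\| \leq \frac{\epsilon}{6}, \qquad \|\nabla^{2}f(x_* )^{-\frac{1}{2}} (B_0 - \nabla^{2}f(x_* ))\nabla^{2}f(x_* )^{-\frac{1}{2}}\|_F \leq \delta,$$ where $\epsilon,\delta\in(0,\frac12)$ are such that for some $\rho\in(0,1)$, $$\max_{k \geq 0}\left[\phi_k(2\delta + 1)\frac{4}{(1 - \epsilon)^2} + \frac{3 + \epsilon}{1 - \epsilon}\right]\frac{\epsilon}{1 - \rho} \leq \delta, \qquad \frac{\epsilon}{3} + 2\delta \leq (1 - 2\delta)\rho .$$ Then $\{x_k\}$ converges to $x_*$ at the superlinear rate: for all $k\ge1$, $$\frac{\|\nabla^{2}f(x_* )^\frac{1}{2}(x_k - x_* )\|}{\|\nabla^{2}f(x_* )^\frac{1}{2}(x_0 - x_* )\|} \leq \left(\frac{2\sqrt{2}\,\delta(1 + \rho)(1 + \frac{\epsilon}{3})q\sqrt{k} + \frac{(1 + \rho)(1 + \frac{\epsilon}{3})\epsilon}{3(1 - \rho)}}{k}\right)^k,$$ $$\frac{f(x_k) - f(x_* )}{f(x_0) - f(x_*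 )} \leq \left(1 + \frac{\epsilon}{3}\right)^2\left(\frac{2\sqrt{2}\,\delta(1 + \rho)(1 + \frac{\epsilon}{3})q\sqrt{k} + \frac{(1 + \rho)(1 + \frac{\epsilon}{3})\epsilon}{3(1 - \rho)}}{k}\right)^{2k},$$ where $q = \max_{k \geq 0}\sqrt{\frac{1}{\phi_k + (1 - \phi_k)\frac{1 - 2\delta}{1 + 2\delta}}} \in \left[1, \sqrt{\frac{1 + 2\delta}{1 - 2\delta}}\right]$.
   Context: Self-concordant function: $f$ satisfies (i) $f$ is three times continuously differentiable, (ii) $\nabla^2 f(x)\succ0$ for all $x\in\mathrm{dom}(f)$, and (iii) $\left.\frac{d}{dt}\nabla^2 f(x+ty)\right|_{t=0}\preceq 2\left(y^\top\nabla^2 f(x)y\right)^{1/2}\nabla^2 f(x)$ for all $x\in\mathrm{dom}(f)$, $y\in\mathbb{R}^d$. Here $A\preceq B$ means $B-A$ is symmetric positive semidefinite. $f$ is assumed to have a unique minimizer, denoted $x_*$. Convex Broyden class of quasi-Newton methods (unit step size): given $x_0$, a symmetric positive-definite $B_0\in\mathbb{R}^{d\times d}$ and parameters $\phi_k\in[0,1]$, for $k=0,1,2,\dots$ set $x_{k+1}=x_k-B_k^{-1}\nabla f(x_k)$, $s_k=x_{k+1}-x_k$, $y_k=\nabla f(x_{k+1})-\nabla f(x_k)$, and $B_{k+1}=\phi_k B^{DFP}_{k+1}+(1-\phi_k)B^{BFGS}_{k+1}$, where $$B^{DFP}_{k+1} = \left(I-\frac{y_k s_k^\top}{y_k^\top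 s_k}\right) B_k \left(I-\frac{ s_ky_k^\top}{s_k^\top y_k}\right) +\frac{y_k y_k^\top}{y_k^\top s_k},\qquad B^{BFGS}_{k+1} = B_k - \frac{B_k s_k s_k^\top B_k}{s_k^\top B_k s_k} + \frac{y_k y_k^\top}{s_k^\top y_k}.$$ The algorithm terminates if $s_k=0$ (in which case $x_k=x_*$); it is assumed throughout that $s_k\ne0$ for all $k$. Then $s_k^\top y_k>0$ and all $B_k$ are symmetric positive-definite. $\|\cdot\|$ is the Euclidean norm of vectors and the induced 2-norm of matrices, $\|\cdot\|_F$ is the Frobenius norm, and $A^{1/2},A^{-1/2}$ denote the symmetric positive-definite square roots of $A$ and $A^{-1}$. The maxima over $k\ge0$ are understood as suprema. *)

(* Defs.v *)
From HB Require Import structures.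
From mathcomp Require Import all_boot all_order all_algebra.
From mathcomp Require Import all_classical all_reals all_analysis.
Set Implicit Arguments.
Unset Strict Implicit.
Unset Printing Implicit Defensive.
Import Order.TTheory GRing.Theory Num.Theory.
Import numFieldNormedType.Exports.
Local Open Scope classical_set_scope.
Local Open Scope ring_scope.

Section LinearAlgebra.
Context {R : realType} {d : nat}.
Implicit Types (u v : 'cV[R]_d) (A B : 'M[R]_d).

Definition dotcv u v : R := (u^T *m v) 0 0.

(* The norm `|_| that the library puts on matrices is the sup norm, hence the
   explicit Euclidean and Frobenius norms. *)
Definition enorm v : R := Num.sqrt (\sum_i v i 0 ^+ 2).

Definition fnorm A : R := Num.sqrt (\sum_i \sum_j A i j ^+ 2).

Definition possemidefmx A : Prop :=
  A^T = A /\ forall v, 0 <= dotcv v (A *m v).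

Definition posdefmx A : Prop :=
  A^T = A /\ forall v, v != 0 -> 0 < dotcv v (A *m v).

Definition lemx A B : Prop := possemidefmx (B - A).

(* Meaningful when A is positive definite, in which case such an S exists and is
   unique. *)
Definition sqrtmx A : 'M[R]_d :=
  xget 0 [set S : 'M[R]_d | posdefmx S /\ S *m S = A].

End LinearAlgebra.

Section SelfConcordance.
Context {R : realType} {d : nat}.
Implicit Types (D : set 'cV[R]_d) (f : 'cV[R]_d -> R) (x y : 'cV[R]_d).

(* A function with domain D is a total function of which only the values on D
   matter; D is meant to be open, so that derivatives at points of D do not
   depend on the values outside of D. *)
Fixpoint continuously_differentiable (n : nat) D f : Prop :=
  match n with
  | 0 => forall x, D x -> {for x, continuous f}
  | n'.+1 => (forall x, D x -> differentiable f x) /\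
             forall v, continuously_differentiable n' D (fun x => 'D_v f x)
  end.

Definition gradient f x : 'cV[R]_d := \col_i 'D_(delta_mx i 0) f x.

Definition hessian f x : 'M[R]_d :=
  \matrix_(i, j) 'D_(delta_mx j 0) (fun z => 'D_(delta_mx i 0) f z) x.

Definition self_concordant D f : Prop :=
  [/\ continuously_differentiable 3 D f,
      forall x, D x -> posdefmx (hessian f x) &
      forall x y, D x ->
        lemx (derive1 (fun t : R => hessian f (x + t *: y)) 0)
             ((2 * Num.sqrt (dotcv y (hessian f x *m y))) *: hessian f x)].

Definition unique_minimizer D f x : Prop :=
  D x /\ forall z, D z -> z != x -> f x < f z.

End SelfConcordance.

Section ConvexBroydenClass.
Context {R : realType} {d : nat}.
Implicit Types (B : 'M[R]_d) (s y : 'cV[R]_d).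

Definition DFP_update B s y : 'M[R]_d :=
  (1%:M - (dotcv y s)^-1 *: (y *m s^T)) *m B
    *m (1%:M - (dotcv s y)^-1 *: (s *m y^T))
  + (dotcv y s)^-1 *: (y *m y^T).

Definition BFGS_update B s y : 'M[R]_d :=
  B - (dotcv s (B *m s))^-1 *: (B *m s *m s^T *m B)
  + (dotcv s y)^-1 *: (y *m y^T).

Definition broyden_update (phi : R) B s y : 'M[R]_d :=
  phi *: DFP_update B s y + (1 - phi) *: BFGS_update B s y.

(* The method evaluates the gradient at every iterate, so that a run of it
   presupposes that the iterates remain in the domain of f. *)
Record broyden_iterates (D : set 'cV[R]_d) (f : 'cV[R]_d -> R)
    (phi : nat -> R) (x : nat -> 'cV[R]_d) (B : nat -> 'M[R]_d) : Prop := {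
  broyden_posdef0 : posdefmx (B 0%N);
  broyden_dom : forall k, D (x k);
  broyden_step : forall k,
    x k.+1 = x k - invmx (B k) *m gradient f (x k);
  broyden_hess : forall k,
    B k.+1 = broyden_update (phi k) (B k)
               (x k.+1 - x k) (gradient f (x k.+1) - gradient f (x k))
}.

End ConvexBroydenClass.

(* Main.v *)
Require Import Defs.
From mathcomp Require Import all_boot all_order all_algebra.
From mathcomp Require Import all_classical all_reals all_analysis.
From mathcomp Require Import complex ring lra.
Import Order.TTheory GRing.Theory Num.Theory.
Import numFieldNormedType.Exports.
Local Open Scope classical_set_scope.
Local Open Scope ring_scope.

(** Let [H] be the Hessian of [f] at the minimizer [xs] and [S] its square root.
    In the coordinates [r = S (x - xs)], gradients become [S^-1 grad f], Hessian
    approximations become [S^-1 B S^-1], and the Hessian at the minimizer becomes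
    the identity.  The updates of the Broyden class are covariant under this
    change of variables ([broyden_update_congr]), so that everything can be
    measured in Euclidean and Frobenius norms.  Two estimates carry the proof.

    The first one comes from self-concordance.  Along a segment of direction [r],
    the function [h(t) = r . f''(x + t r) r] satisfies [|h'| <= 2 h^(3/2)], hence
    [h^(-1/2)] changes at most at unit speed.  With this bound on [h], the
    Hessians at local distance [sigma] differ by factors between [(1 - sigma)^2]
    and [(1 - sigma)^(-2)] ([sc_hessian_segment]).  Integrating along segments,
    the normalized gradient [g] satisfies [|g - r| <= 2 |r|^2], a secant pair
    satisfies [|y - s| <= 6 |r| |s|], and [f - f(xs)] is [|r|^2 / 2] up to factors
    [(1 - |r|)^2] and [(1 - |r|)^(-2)].

    The second one is about a single update.  Let [E = B - I] and let [u] be the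
    unit vector along the step [s].  If [y = s], then the squared Frobenius norm
    of [E] drops by at least [c |E u|^2], with [c = 1] for DFP and
    [c = (1 - 2 delta) / (1 + 2 delta)] for BFGS; for [|y - s| <= tau |s|] there is
    an additional error of order [tau] ([broyden_update_fnorm]).

    These two are combined by a potential: the Frobenius error plus a multiple of
    [|r|] large enough to pay for all the later perturbations.  As long as it is
    at most [2 delta], the error [|r|] shrinks by the factor [rho], the
    perturbations form a geometric series, and the potential does not increase;
    so this situation persists forever.  Since the potential drops by a multiple
    of [|E_k u_k|^2] at step [k], these squares have a sum of at most
    [8 delta^2 q^2].  Finally [B_k s_k = - g_k] means
    [r_(k+1) = - E_k s_k - (g_k - r_k)], so that [|r|] is multiplied at step [k] by
    at most [(1 + rho) |E_k u_k| + 2 |r_k|].  By the Cauchy-Schwarz inequality the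
    first [k] of these factors have a sum of order [sqrt k], and by the
    inequality of arithmetic and geometric means their product is at most the
    [k]-th power of that sum over [k] ([superlinear_rate]).  This improves on the
    claimed rate by a factor [1 + eps / 3] per step, and that margin absorbs the
    constants in the comparison of [f - f(xs)] with [|r|^2] ([value_ratio]). *)

(** * Euclidean and Frobenius norms *)

Section EuclideanSums.
Context {R : realType} {I : finType}.
Implicit Types a b : I -> R.

Lemma sum_sqr_ge0 a : 0 <= \sum_i a i ^+ 2.
Proof. by apply: sumr_ge0 => i _; apply: sqr_ge0. Qed.

Lemma cauchy_schwarz_sum a b :
  \sum_i a i * b i <= Num.sqrt (\sum_i a i ^+ 2) * Num.sqrt (\sum_i b i ^+ 2).
Proof.
set A := \sum_i a i ^+ 2; set B := \sum_i b i ^+ 2; set C := \sum_i a i * b i.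
have A0 : 0 <= A by apply: sum_sqr_ge0.
have B0 : 0 <= B by apply: sum_sqr_ge0.
suff CAB : C ^+ 2 <= A * B.
  rewrite -sqrtrM//; apply: (le_trans (ler_norm _)).
  by rewrite -sqrtr_sqr ler_wsqrtr.
have [B_eq0|B_neq0] := eqVneq B 0.
  suff -> : C = 0 by rewrite expr0n mulr_ge0.
  apply: big1 => i _; have /eqP := B_eq0.
  rewrite /B psumr_eq0 => [/allP /(_ i)|j _]; last exact: sqr_ge0.
  rewrite mem_index_enum => /(_ isT) /=; rewrite sqrf_eq0 => /eqP ->.
  by rewrite mulr0.
have Bgt0 : 0 < B by rewrite lt_def B_neq0.
have : 0 <= \sum_i (a i * B - b i * C) ^+ 2 by apply: sum_sqr_ge0.
have -> : \sum_i (a i * B - b i * C) ^+ 2 = B * (A * B - C ^+ 2).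
  transitivity (\sum_i (B ^+ 2 * a i ^+ 2 + - (2 * B * C) * (a i * b i)
                        + C ^+ 2 * b i ^+ 2)); first by apply: eq_bigr => i _; ring.
  by rewrite !big_split /= -!mulr_sumr -/A -/B -/C; ring.
by rewrite pmulr_rge0 // subr_ge0.
Qed.

Lemma minkowski_sum a b :
  Num.sqrt (\sum_i (a i + b i) ^+ 2)
  <= Num.sqrt (\sum_i a i ^+ 2) + Num.sqrt (\sum_i b i ^+ 2).
Proof.
rewrite -[leRHS]ger0_norm ?addr_ge0 ?sqrtr_ge0// -sqrtr_sqr ler_wsqrtr//.
rewrite sqrrD !sqr_sqrtr ?sum_sqr_ge0//.
have -> : \sum_i (a i + b i) ^+ 2 =
    \sum_i a i ^+ 2 + (\sum_i a i * b i) *+ 2 + \sum_i b i ^+ 2.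
  rewrite -sumrMnl -!big_split /=; apply: eq_bigr => i _; rewrite sqrrD; ring.
by rewrite lerD2r lerD2l lerMn2r /= cauchy_schwarz_sum.
Qed.

End EuclideanSums.

Section DotProduct.
Context {R : realType} {d : nat}.
Implicit Types (u v w : 'cV[R]_d) (A : 'M[R]_d) (c : R).

Lemma dotcvE u v : dotcv u v = \sum_i u i 0 * v i 0.
Proof. by rewrite /dotcv mxE; apply: eq_bigr => i _; rewrite mxE. Qed.

Lemma dotcvC u v : dotcv u v = dotcv v u.
Proof. by rewrite !dotcvE; apply: eq_bigr => i _; rewrite mulrC. Qed.

Lemma dotcvDr u v w : dotcv u (v + w) = dotcv u v + dotcv u w.
Proof. by rewrite /dotcv mulmxDr mxE. Qed.

Lemma dotcvZr c u v : dotcv u (c *: v) = c * dotcv u v.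
Proof. by rewrite /dotcv -scalemxAr mxE. Qed.

Lemma dotcvNr u v : dotcv u (- v) = - dotcv u v.
Proof. by rewrite /dotcv mulmxN mxE. Qed.

Lemma dotcvBr u v w : dotcv u (v - w) = dotcv u v - dotcv u w.
Proof. by rewrite dotcvDr dotcvNr. Qed.

Lemma dotcvDl u v w : dotcv (u + v) w = dotcv u w + dotcv v w.
Proof. by rewrite !(dotcvC _ w) dotcvDr. Qed.

Lemma dotcvZl c u v : dotcv (c *: u) v = c * dotcv u v.
Proof. by rewrite !(dotcvC _ v) dotcvZr. Qed.

Lemma dotcvNl u v : dotcv (- u) v = - dotcv u v.
Proof. by rewrite !(dotcvC _ v) dotcvNr. Qed.

Lemma dotcv0l u : dotcv 0 u = 0.
Proof. by rewrite /dotcv trmx0 mul0mx mxE. Qed.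

Lemma dotcv0r u : dotcv u 0 = 0.
Proof. by rewrite dotcvC dotcv0l. Qed.

Definition dotcv_lin := (dotcvDl, dotcvDr, dotcvNl, dotcvNr, dotcvZl, dotcvZr).

Lemma dotcv_mull A u v : dotcv (A *m u) v = dotcv u (A^T *m v).
Proof. by rewrite /dotcv trmx_mul mulmxA. Qed.

Lemma mulmx_outer u v w : (u *m v^T) *m w = dotcv v w *: u.
Proof.
by rewrite -mulmxA; apply/matrixP => i j; rewrite !ord1 !mxE big_ord1 mulrC.
Qed.

Lemma enorm_ge0 v : 0 <= enorm v.
Proof. exact: sqrtr_ge0. Qed.

Lemma enorm_sqr v : enorm v ^+ 2 = dotcv v v.
Proof.
rewrite sqr_sqrtr ?sum_sqr_ge0// dotcvE; apply: eq_bigr => i _.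
by rewrite expr2.
Qed.

Lemma dotcv_ge0 v : 0 <= dotcv v v.
Proof. by rewrite -enorm_sqr sqr_ge0. Qed.

Lemma enorm_eq0 v : (enorm v == 0) = (v == 0).
Proof.
apply/idP/idP => [|/eqP ->]; last first.
  by rewrite -sqrf_eq0 enorm_sqr dotcv0l.
rewrite -sqrf_eq0 enorm_sqr dotcvE psumr_eq0 => [/allP v0|i _]; last first.
  by rewrite -expr2 sqr_ge0.
apply/eqP/matrixP => i j; rewrite (ord1 j) mxE; apply/eqP.
by have := v0 i (mem_index_enum _); rewrite /= -expr2 sqrf_eq0.
Qed.

Lemma enorm_gt0 v : (0 < enorm v) = (v != 0).
Proof. by rewrite lt_def enorm_ge0 andbT enorm_eq0. Qed.

Lemma enorm0 : enorm (0 : 'cV[R]_d) = 0.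
Proof. by apply/eqP; rewrite enorm_eq0. Qed.

Lemma enormZ c v : enorm (c *: v) = `|c| * enorm v.
Proof.
apply/eqP; rewrite -(@eqrXn2 _ 2) ?mulr_ge0 ?enorm_ge0//.
by rewrite exprMn !enorm_sqr dotcvZl dotcvZr mulrA real_normK ?num_real// expr2.
Qed.

Lemma enormN v : enorm (- v) = enorm v.
Proof. by rewrite -scaleN1r enormZ normrN1 mul1r. Qed.

Lemma ler_enormD u v : enorm (u + v) <= enorm u + enorm v.
Proof.
rewrite /enorm; under eq_bigr do rewrite mxE.
exact: (minkowski_sum (fun i => u i 0) (fun i => v i 0)).
Qed.

Lemma ler_enormB u v : enorm (u - v) <= enorm u + enorm v.
Proof. by rewrite -(enormN v) ler_enormD. Qed.

Lemma dotcv_le u v : dotcv u v <= enorm u * enorm v.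
Proof.
by rewrite dotcvE; apply: (cauchy_schwarz_sum (fun i => u i 0) (fun i => v i 0)).
Qed.

Lemma normr_dotcv_le u v : `|dotcv u v| <= enorm u * enorm v.
Proof.
by rewrite ler_norml dotcv_le andbT lerNl -dotcvNl -(enormN u) dotcv_le.
Qed.

(** Norms are bounded by testing a vector against itself; dividing by [enorm v]
    is done here once, so that the case [v = 0] need not be treated elsewhere. *)
Lemma enorm_le_dotcv v c : (dotcv v v <= enorm v * c) -> 0 <= c -> enorm v <= c.
Proof.
rewrite -enorm_sqr expr2 => vvc c0.
have [v0|] := boolP (v == 0); first by rewrite (eqP v0) enorm0.
by rewrite -enorm_gt0 => v0; rewrite ler_pM2l in vvc.
Qed.

End DotProduct.

Section FrobeniusNorm.
Context {R : realType} {d : nat}.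
Implicit Types (u v w z : 'cV[R]_d) (A B C : 'M[R]_d) (c : R).

Definition frob_dot A B : R := \sum_i \sum_j A i j * B i j.

Lemma frob_dotC A B : frob_dot A B = frob_dot B A.
Proof. by apply: eq_bigr => i _; apply: eq_bigr => j _; rewrite mulrC. Qed.

Lemma frob_dotDl A B C : frob_dot (A + B) C = frob_dot A C + frob_dot B C.
Proof.
rewrite -big_split; apply: eq_bigr => i _; rewrite -big_split /=.
by apply: eq_bigr => j _; rewrite mxE mulrDl.
Qed.

Lemma frob_dotZl c A B : frob_dot (c *: A) B = c * frob_dot A B.
Proof.
rewrite mulr_sumr; apply: eq_bigr => i _; rewrite mulr_sumr.
by apply: eq_bigr => j _; rewrite mxE mulrA.
Qed.

Lemma frob_dotNl A B : frob_dot (- A) B = - frob_dot A B.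
Proof. by rewrite -scaleN1r frob_dotZl mulN1r. Qed.

Lemma frob_dotDr A B C : frob_dot A (B + C) = frob_dot A B + frob_dot A C.
Proof. by rewrite !(frob_dotC A) frob_dotDl. Qed.

Lemma frob_dotZr c A B : frob_dot A (c *: B) = c * frob_dot A B.
Proof. by rewrite !(frob_dotC A) frob_dotZl. Qed.

Lemma frob_dotNr A B : frob_dot A (- B) = - frob_dot A B.
Proof. by rewrite !(frob_dotC A) frob_dotNl. Qed.

Definition frob_dot_lin :=
  (frob_dotDl, frob_dotDr, frob_dotNl, frob_dotNr, frob_dotZl, frob_dotZr).

Lemma frob_dot_outer A u v : frob_dot A (u *m v^T) = dotcv u (A *m v).
Proof.
rewrite dotcvE; apply: eq_bigr => i _; rewrite mxE mulr_sumr.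
by apply: eq_bigr => j _; rewrite !mxE big_ord1 !mxE mulrCA.
Qed.

Lemma frob_dot_outer2 u v w z :
  frob_dot (u *m v^T) (w *m z^T) = dotcv u w * dotcv v z.
Proof. by rewrite frob_dot_outer mulmx_outer dotcvZr mulrC (dotcvC u). Qed.

Lemma fnorm_ge0 A : 0 <= fnorm A.
Proof. exact: sqrtr_ge0. Qed.

Lemma fnorm_sqr A : fnorm A ^+ 2 = frob_dot A A.
Proof.
rewrite sqr_sqrtr; last by apply: sumr_ge0 => i _; apply: sum_sqr_ge0.
by apply: eq_bigr => i _; apply: eq_bigr => j _; rewrite expr2.
Qed.

Lemma fnormE A : fnorm A = Num.sqrt (\sum_(p : 'I_d * 'I_d) A p.1 p.2 ^+ 2).
Proof. by rewrite /fnorm pair_bigA. Qed.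

Lemma ler_fnormD A B : fnorm (A + B) <= fnorm A + fnorm B.
Proof.
rewrite !fnormE; under eq_bigr do rewrite mxE.
exact: (minkowski_sum (fun p : 'I_d * 'I_d => A p.1 p.2) (fun p => B p.1 p.2)).
Qed.

Lemma fnormZ c A : fnorm (c *: A) = `|c| * fnorm A.
Proof.
apply/eqP; rewrite -(@eqrXn2 _ 2) ?mulr_ge0 ?fnorm_ge0//.
by rewrite exprMn !fnorm_sqr !frob_dot_lin mulrA real_normK ?num_real// expr2.
Qed.

Lemma fnormN A : fnorm (- A) = fnorm A.
Proof. by rewrite -scaleN1r fnormZ normrN1 mul1r. Qed.

Lemma fnorm_outer u v : fnorm (u *m v^T) = enorm u * enorm v.
Proof.
apply/eqP; rewrite -(@eqrXn2 _ 2) ?mulr_ge0 ?enorm_ge0 ?fnorm_ge0//.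
by rewrite fnorm_sqr frob_dot_outer2 exprMn !enorm_sqr.
Qed.

Lemma frob_dot_le A B : frob_dot A B <= fnorm A * fnorm B.
Proof.
rewrite !fnormE /frob_dot pair_bigA /=.
exact: (cauchy_schwarz_sum (fun p : 'I_d * 'I_d => A p.1 p.2) (fun p => B p.1 p.2)).
Qed.

Lemma enorm_mulmx_le A v : enorm (A *m v) <= fnorm A * enorm v.
Proof.
apply: enorm_le_dotcv; last by rewrite mulr_ge0 ?fnorm_ge0 ?enorm_ge0.
by rewrite -frob_dot_outer mulrCA -fnorm_outer frob_dot_le.
Qed.

End FrobeniusNorm.

(** * One update of the convex Broyden class *)

Section BroydenUpdate.
Context {R : realType} {d : nat}.
Implicit Types (A B E S : 'M[R]_d) (s y u v : 'cV[R]_d) (phi c tau : R).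

Lemma trmxD A B : (A + B)^T = A^T + B^T.
Proof. exact: linearD. Qed.

Lemma trmxN A : (- A)^T = - A^T.
Proof. exact: linearN. Qed.

Lemma trmxZ c A : (c *: A)^T = c *: A^T.
Proof. exact: linearZ. Qed.

Lemma tr_outer u v : (u *m v^T)^T = v *m u^T.
Proof. by rewrite trmx_mul trmxK. Qed.

Lemma broyden_update_tr phi B s y :
  B^T = B -> (broyden_update phi B s y)^T = broyden_update phi B s y.
Proof.
move=> Bsym; rewrite /broyden_update /DFP_update /BFGS_update.
rewrite !(trmxD, trmxN, trmxZ, trmx_mul, trmxK) trmx1 Bsym.
by rewrite (dotcvC y s) !mulmxA.
Qed.

Lemma broyden_update_scale phi B s y c : c != 0 ->
  broyden_update phi B (c *: s) (c *: y) = broyden_update phi B s y.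
Proof.
move=> c0; rewrite /broyden_update /DFP_update /BFGS_update.
have cc a : (c * (c * a))^-1 * (c * c) = a^-1.
  by rewrite mulrA invfM mulrAC mulVf ?mul1r// mulf_neq0.
have outer_cc v w : (c *: v) *m (c *: w)^T = (c * c) *: (v *m w^T).
  have -> : (c *: w)^T = c *: w^T by apply: linearZ.
  by rewrite -scalemxAl -scalemxAr scalerA.
have Bcc : (B *m (c *: s) *m (c *: s)^T) = (c * c) *: (B *m s *m s^T).
  by rewrite -mulmxA outer_cc -scalemxAr mulmxA.
rewrite !outer_cc Bcc -!scalemxAl -!scalemxAr !dotcvZl !dotcvZr.
by rewrite !scalerA !cc.
Qed.

(** Covariance under a linear change of variables, which reduces the analysis to
    the case where the Hessian at the minimizer is the identity: steps transform
    by [S], gradients by its inverse, Hessian approximations by congruence. *)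
Lemma broyden_update_congr phi S B s y : S^T = S -> S \in unitmx ->
  broyden_update phi (invmx S *m B *m invmx S) (S *m s) (invmx S *m y)
  = invmx S *m broyden_update phi B s y *m invmx S.
Proof.
move=> Ssym Su; have Tsym : (invmx S)^T = invmx S by rewrite trmx_inv Ssym.
have ST : S *m invmx S = 1%:M by rewrite mulmxV.
have TS : invmx S *m S = 1%:M by rewrite mulVmx.
move: (invmx S) Tsym ST TS => T Tsym ST TS.
have dys : dotcv (T *m y) (S *m s) = dotcv y s.
  by rewrite dotcv_mull Tsym mulmxA TS mul1mx.
have TSs : T *m (S *m s) = s by rewrite mulmxA TS mul1mx.
have dsBs : dotcv (S *m s) (T *m B *m T *m (S *m s)) = dotcv s (B *m s).
  by rewrite -mulmxA TSs dotcv_mull Ssym !mulmxA ST mul1mx.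
have yyT : (T *m y) *m (T *m y)^T = T *m (y *m y^T) *m T.
  by rewrite trmx_mul Tsym !mulmxA.
rewrite /broyden_update mulmxDr mulmxDl -!scalemxAr -!scalemxAl.
congr (_ *: _ + _ *: _).
  rewrite /DFP_update (dotcvC (S *m s)) (dotcvC s) dys yyT (mulmxDr T) (mulmxDl _ _ T).
  congr (_ + _); last by rewrite -scalemxAr -scalemxAl.
  have L a : (1%:M - a *: (T *m y *m (S *m s)^T)) *m T
      = T *m (1%:M - a *: (y *m s^T)).
    rewrite mulmxBl mulmxBr mul1mx mulmx1 -scalemxAl -scalemxAr.
    by rewrite trmx_mul Ssym -!mulmxA ST mulmx1.
  have L' a : T *m (1%:M - a *: (S *m s *m (T *m y)^T))
      = (1%:M - a *: (s *m y^T)) *m T.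
    rewrite mulmxBl mulmxBr mul1mx mulmx1 -scalemxAl -scalemxAr.
    by rewrite trmx_mul Tsym !mulmxA TS mul1mx.
  have regroup X Y : X *m (T *m B *m T) *m Y = X *m T *m B *m (T *m Y).
    by rewrite !mulmxA.
  by rewrite regroup L L' !mulmxA.
rewrite /BFGS_update (dotcvC (S *m s) (T *m y)) (dotcvC s y) dys dsBs yyT.
rewrite (mulmxDr T) (mulmxDl _ _ T) (mulmxBr T) (mulmxBl _ _ T) -!scalemxAr -!scalemxAl.
congr (_ - _ *: _ + _).
have -> : T *m B *m T *m (S *m s) = T *m (B *m s) by rewrite -mulmxA TSs mulmxA.
have sT : (S *m s)^T *m (T *m B *m T) = s^T *m B *m T.
  by rewrite trmx_mul Ssym !mulmxA -(mulmxA _ S T) ST mulmx1.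
by rewrite -mulmxA sT !mulmxA.
Qed.

(** When the gradient difference equals the step [u], the new error is [P E P],
    where [E = B - I] and [P] is the orthogonal projection that annihilates [u].
    The squared norm thus drops by [2 |E u|^2 - (u . E u)^2], and
    [(u . E u)^2 <= |E u|^2]. *)
Lemma DFP_update_fnorm B u : B^T = B -> dotcv u u = 1 ->
  enorm ((B - 1%:M) *m u) ^+ 2
  <= fnorm (B - 1%:M) ^+ 2 - fnorm (DFP_update B u u - 1%:M) ^+ 2.
Proof.
move=> Bsym uu; set E := B - 1%:M; set e := E *m u.
have Esym : E^T = E by rewrite trmxD trmxN Bsym trmx1.
have BE : B = E + 1%:M by rewrite subrK.
clearbody E.
have eT : u^T *m E = e^T by rewrite trmx_mul Esym.
have -> : DFP_update B u u - 1%:M =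
    E - (u *m e^T) - (e *m u^T) + dotcv u e *: (u *m u^T).
  rewrite /DFP_update uu invr1 !scale1r BE; set P := u *m u^T.
  have PP : P *m P = P by rewrite /P mulmxA mulmx_outer uu scale1r.
  have PE : P *m E = u *m e^T by rewrite /P -mulmxA eT.
  have EP : E *m P = e *m u^T by rewrite /P mulmxA.
  have PEP : P *m E *m P = dotcv u e *: P.
    by rewrite PE /P mulmxA mulmx_outer dotcvC scalemxAl.
  rewrite !(mulmxDl, mulmxDr, mulmxN, mulNmx, mul1mx, mulmx1).
  rewrite PP PEP PE EP.
  apply/matrixP => i j; rewrite !mxE; ring.
set p := fnorm E ^+ 2.
rewrite [X in _ - X]fnorm_sqr !frob_dot_lin.
rewrite !(frob_dotC (_ *m _) E) !frob_dot_outer2 !frob_dot_outer -fnorm_sqr.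
have uEe : dotcv u (E *m e) = dotcv e e by rewrite -{1}Esym -dotcv_mull.
rewrite -/e -/p uEe uu enorm_sqr (dotcvC e u).
have : dotcv u e ^+ 2 <= dotcv e e.
  have := normr_dotcv_le u e.
  rewrite -(ler_pXn2r (n := 2)) ?nnegrE ?mulr_ge0 ?enorm_ge0 //.
  by rewrite exprMn !enorm_sqr uu mul1r real_normK ?num_real.
lra.
Qed.

(** With [b = B u], [m_j = u . B^j u], the square of the Frobenius norm drops by
    [1 - 2 m_2 / m_1 + 2 m_3 / m_1 - (m_2 / m_1)^2], which dominates
    [(m_1 - 2 m_2 + m_3) / m_1 = (E u . B E u) / m_1] because
    [m_2^2 <= m_1 m_3] is the Cauchy-Schwarz inequality for [B]. *)
Lemma BFGS_update_fnorm B u lo hi : B^T = B -> dotcv u u = 1 ->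
  0 < lo ->
  (forall v, lo * dotcv v v <= dotcv v (B *m v) <= hi * dotcv v v) ->
  lo / hi * enorm ((B - 1%:M) *m u) ^+ 2
  <= fnorm (B - 1%:M) ^+ 2 - fnorm (BFGS_update B u u - 1%:M) ^+ 2.
Proof.
move=> Bsym uu lo0 Bitv; set E := B - 1%:M; set e := E *m u; set b := B *m u.
have Bge0 v : 0 <= dotcv v (B *m v).
  have /andP[+ _] := Bitv v; apply: le_trans.
  by rewrite mulr_ge0 ?dotcv_ge0 // ltW.
have BE : B = E + 1%:M by rewrite subrK.
have eE : e = b - u by rewrite /e mulmxBl mul1mx.
have bEb : dotcv b (E *m b) = dotcv b (B *m b) - dotcv b b.
  by rewrite mulmxBl mul1mx dotcvBr.
clearbody E.
have Bselfadj v w : dotcv v (B *m w) = dotcv (B *m v) w by rewrite dotcv_mull Bsym.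
set m1 := dotcv u b; set m2 := dotcv b b; set m3 := dotcv b (B *m b).
have m1lo : lo <= m1 by have /andP[+ _] := Bitv u; rewrite uu mulr1.
have m1hi : m1 <= hi by have /andP[_] := Bitv u; rewrite uu mulr1.
have m1gt0 : 0 < m1 by apply: lt_le_trans m1lo.
have uBb : dotcv u (B *m b) = m2 by rewrite Bselfadj.
have m2m3 : (m2 / m1) ^+ 2 <= m3 / m1.
  have := Bge0 (b - (m2 / m1) *: u).
  rewrite mulmxBr -scalemxAr -/b !dotcv_lin -/m3 -/m2 uBb -/m1 => m3ge.
  have -> : (m2 / m1) ^+ 2 = m2 ^+ 2 / m1 / m1 by field; apply/lt0r_neq0.
  rewrite ler_pM2r ?invr_gt0 //; rewrite -subr_ge0; apply: le_trans m3ge _.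
  rewrite le_eqVlt; apply/orP; left; apply/eqP; field; exact/lt0r_neq0.
have eBe : dotcv e (B *m e) = m3 - 2 * m2 + m1.
  by rewrite eE mulmxBr -/b !dotcv_lin -/m3 -/m2 uBb -/m1; ring.
have e2 : dotcv e e <= dotcv e (B *m e) / lo.
  by rewrite ler_pdivlMr // mulrC; have /andP[] := Bitv e.
have drop : lo / hi * enorm e ^+ 2 <= 1 - 2 * (m2 / m1) + m3 / m1.
  have -> : 1 - 2 * (m2 / m1) + m3 / m1 = dotcv e (B *m e) / m1.
    by rewrite eBe; field; apply/lt0r_neq0.
  rewrite enorm_sqr mulrAC; apply: ler_pM; first by rewrite mulr_ge0 ?dotcv_ge0 // ltW.
  - by rewrite invr_ge0 (le_trans _ m1hi) // ltW.
  - by have /andP[] := Bitv e.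
  - by rewrite lef_pV2 ?posrE // (lt_le_trans m1gt0).
have -> : BFGS_update B u u - 1%:M = E - m1^-1 *: (b *m b^T) + u *m u^T.
  rewrite /BFGS_update uu invr1 scale1r -mulmxA.
  have -> : u^T *m B = b^T by rewrite trmx_mul Bsym.
  by rewrite -/b -/m1 BE; apply/matrixP => i j; rewrite !mxE; ring.
set p := fnorm E ^+ 2; apply: le_trans drop _.
rewrite (fnorm_sqr (_ + _)) !frob_dot_lin.
rewrite !(frob_dotC (_ *m _) E) !frob_dot_outer2 !frob_dot_outer -fnorm_sqr.
rewrite -/p -/e uu (dotcvC b u) bEb -/m1 -/m2 -/m3.
have -> : dotcv u e = m1 - 1 by rewrite eE dotcvBr uu.
rewrite -subr_ge0.
apply: le_trans (_ : 0 <= m3 / m1 - (m2 / m1) ^+ 2) _; first by rewrite subr_ge0.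
rewrite le_eqVlt; apply/orP; left; apply/eqP; field; exact/lt0r_neq0.
Qed.

Lemma enorm_unit u : dotcv u u = 1 -> enorm u = 1.
Proof.
by move=> uu; apply/eqP; rewrite -(@eqrXn2 _ 2) ?enorm_ge0// enorm_sqr uu expr1n.
Qed.

Lemma dotcv_perturb u y tau : dotcv u u = 1 -> enorm (y - u) <= tau ->
  1 - tau <= dotcv u y.
Proof.
move=> uu ytau; have -> : y = u + (y - u) by rewrite addrC subrK.
rewrite dotcvDr uu lerD2l lerNl -dotcvNr; apply: le_trans (dotcv_le _ _) _.
by rewrite enorm_unit // mul1r enormN.
Qed.

Lemma outer_perturb u y tau :
  dotcv u u = 1 -> enorm (y - u) <= tau -> tau < 1 ->
  fnorm ((dotcv u y)^-1 *: (y *m y^T) - u *m u^T) <= (3 + tau) / (1 - tau) * tau.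
Proof.
move=> uu ztau tau1; have u1 := enorm_unit u uu.
have := dotcv_perturb u y tau uu ztau.
have -> : y = u + (y - u) by rewrite addrC subrK.
move: ztau; set z := y - u => ztau; rewrite dotcvDr uu => uy_ge.
have tau0 : 0 <= tau by apply: le_trans (enorm_ge0 _) ztau.
have uy0 : 0 < 1 + dotcv u z by apply: lt_le_trans uy_ge; rewrite subr_gt0.
have -> : (1 + dotcv u z)^-1 *: ((u + z) *m (u + z)^T) - u *m u^T =
    (1 + dotcv u z)^-1 *: (u *m z^T + z *m u^T + z *m z^T - dotcv u z *: (u *m u^T)).
  have uT : (u + z)^T = u^T + z^T by apply: linearD.
  rewrite uT mulmxDl !mulmxDr; apply/matrixP => i j; rewrite !mxE; field.
  exact/lt0r_neq0.
rewrite fnormZ ger0_norm ?invr_ge0 ?(ltW uy0) //.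
have dz : `|dotcv u z| <= tau.
  by apply: le_trans (normr_dotcv_le _ _) _; rewrite u1 mul1r.
have num : fnorm (u *m z^T + z *m u^T + z *m z^T - dotcv u z *: (u *m u^T))
    <= (3 + tau) * tau.
  have -> : (3 + tau) * tau = tau + tau + tau * tau + tau by ring.
  apply: le_trans (ler_fnormD _ _) _; rewrite fnormN fnormZ fnorm_outer u1 !mulr1.
  apply: lerD => //; apply: le_trans (ler_fnormD _ _) _; rewrite fnorm_outer.
  apply: lerD; last by rewrite ler_pM ?enorm_ge0.
  apply: le_trans (ler_fnormD _ _) _; rewrite !fnorm_outer u1 mul1r mulr1.
  exact: lerD.
rewrite [leLHS]mulrC [leRHS]mulrAC ler_pM ?fnorm_ge0 ?invr_ge0 ?(ltW uy0) //.
rewrite lef_pV2 ?posrE //.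
by rewrite subr_gt0.
Qed.

Lemma BFGS_update_perturb B u y tau :
  dotcv u u = 1 -> enorm (y - u) <= tau -> tau < 1 ->
  fnorm (BFGS_update B u y - BFGS_update B u u) <= (3 + tau) / (1 - tau) * tau.
Proof.
move=> uu ytau tau1; rewrite /BFGS_update uu invr1 !scale1r opprD addrACA subrr add0r.
exact: outer_perturb.
Qed.

(** With [P] the orthogonal projection along [u], the oblique projection
    [I - u y^T / (u . y)] is [P + u w^T] with [|w| <= tau / (1 - tau)], so that
    the two DFP updates differ by terms that contain [w] at least once, and by
    the difference of the rank-one terms. *)
Lemma DFP_update_perturb B u y tau b : B^T = B ->
  (forall v, enorm (B *m v) <= b * enorm v) ->
  dotcv u u = 1 -> enorm (y - u) <= tau -> tau < 1 ->
  fnorm (DFP_update B u y - DFP_update B u u)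
  <= (b * (4 / (1 - tau) ^+ 2) + (3 + tau) / (1 - tau)) * tau.
Proof.
move=> Bsym Bb uu ytau tau1; have u1 := enorm_unit u uu.
have uy_ge := dotcv_perturb u y tau uu ytau.
have tau0 : 0 <= tau by apply: le_trans (enorm_ge0 _) ytau.
have tau1' : 0 < 1 - tau by rewrite subr_gt0.
have uy0 : 0 < dotcv u y by apply: lt_le_trans uy_ge.
have b0 : 0 <= b by have := Bb u; rewrite u1 mulr1; apply/le_trans/enorm_ge0.
set w := u - (dotcv u y)^-1 *: y; set P := 1%:M - u *m u^T.
have Psym : P^T = P by rewrite /P trmxD trmxN trmx1 tr_outer.
have wz : w = (dotcv u y)^-1 *: (dotcv u (y - u) *: u - (y - u)).
  rewrite /w dotcvBr uu; apply/matrixP => i j; rewrite !mxE; field.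
  exact/lt0r_neq0.
have w_le : enorm w <= tau / (1 - tau).
  have P_le : enorm (dotcv u (y - u) *: u - (y - u)) <= tau.
    apply: le_trans ytau; rewrite -(@ler_pXn2r _ 2) ?nnegrE ?enorm_ge0 //.
    rewrite !enorm_sqr; move: (y - u) => z; rewrite !dotcv_lin uu (dotcvC z u).
    have := sqr_ge0 (dotcv u z); lra.
  rewrite wz enormZ ger0_norm ?invr_ge0 ?(ltW uy0) // mulrC.
  by rewrite ler_pM ?enorm_ge0 ?invr_ge0 ?(ltW uy0) // lef_pV2 ?posrE.
have PBu : enorm (P *m (B *m u)) <= b.
  apply: le_trans (_ : enorm (B *m u) <= _); last by have := Bb u; rewrite u1 mulr1.
  rewrite -(@ler_pXn2r _ 2) ?nnegrE ?enorm_ge0 // !enorm_sqr /P.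
  rewrite mulmxBl mul1mx mulmx_outer; move: (B *m u) => Bu.
  rewrite !dotcv_lin uu (dotcvC Bu u).
  have := sqr_ge0 (dotcv u Bu); lra.
have uBu : `|dotcv u (B *m u)| <= b.
  apply: le_trans (normr_dotcv_le _ _) _; rewrite u1 mul1r.
  by have := Bb u; rewrite u1 mulr1.
have -> : DFP_update B u y - DFP_update B u u =
    w *m (P *m (B *m u))^T + (P *m (B *m u)) *m w^T
    + dotcv u (B *m u) *: (w *m w^T)
    + ((dotcv u y)^-1 *: (y *m y^T) - u *m u^T).
  rewrite /DFP_update uu invr1 !scale1r (dotcvC y u).
  have oblR : 1%:M - (dotcv u y)^-1 *: (u *m y^T) = P + u *m w^T.
    have -> : w^T = u^T - (dotcv u y)^-1 *: y^T.
      by rewrite /w; apply/matrixP => i j; rewrite !mxE.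
    by rewrite mulmxBr -scalemxAr /P addrA subrK.
  have oblL : 1%:M - (dotcv u y)^-1 *: (y *m u^T) = P + w *m u^T.
    by rewrite /w mulmxBl -scalemxAl /P addrA subrK.
  rewrite oblL oblR -/P.
  clearbody w P.
  have uBuw : w *m u^T *m B *m (u *m w^T)
      = dotcv u (B *m u) *: (w *m w^T).
    rewrite -!mulmxA (mulmxA B) (mulmxA u^T) [u^T *m _]mx11_scalar.
    by rewrite mul_scalar_mx scalemxAr.
  have wPBu : w *m u^T *m B *m P = w *m (P *m (B *m u))^T.
    by rewrite !trmx_mul Bsym Psym !mulmxA.
  have PBuw : P *m B *m (u *m w^T) = P *m (B *m u) *m w^T by rewrite !mulmxA.
  rewrite !mulmxDl !mulmxDr uBuw wPBu PBuw.
  move: (P *m B *m P) (P *m (B *m u) *m w^T) (w *m (P *m (B *m u))^T).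
  move: (w *m w^T) (y *m y^T) (u *m u^T) => X1 X2 X3 X4 X5 X6.
  by apply/matrixP => i j; rewrite !mxE; ring.
have t0 : 0 <= tau / (1 - tau) by rewrite divr_ge0 // ltW.
rewrite mulrDl; apply: le_trans (ler_fnormD _ _) (lerD _ _); last exact: outer_perturb.
apply: le_trans (_ : 2 * b * (tau / (1 - tau)) + b * (tau / (1 - tau)) ^+ 2 <= _).
  apply: le_trans (ler_fnormD _ _) (lerD _ _).
    apply: le_trans (ler_fnormD _ _) _; rewrite !fnorm_outer.
    have := ler_pM (enorm_ge0 _) (enorm_ge0 _) w_le PBu; lra.
  rewrite fnormZ fnorm_outer ler_pM ?mulr_ge0 ?enorm_ge0 // expr2.
  by rewrite ler_pM ?enorm_ge0.
have -> : 2 * b * (tau / (1 - tau)) + b * (tau / (1 - tau)) ^+ 2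
   = b * ((2 - tau) / (1 - tau) ^+ 2) * tau by field; apply/lt0r_neq0.
rewrite ler_wpM2r // ler_wpM2l // ler_pM2r ?invr_gt0 ?exprn_gt0 //; lra.
Qed.

(** The decrease of the squared norm in the case [y = s] is a decrease of the norm
    itself, because [|E| + |E'| <= 4 delta]; this form is additive along the
    iteration.  Convexity of the norm combines the DFP and BFGS parts, and the
    perturbation lemmas pass from [y = s] to [|y - s| <= tau |s|].  The coefficient
    of [tau] that involves the size of [B] comes with the factor [phi], since only
    the DFP part multiplies [B] by projections that depend on [y]. *)
Lemma broyden_update_fnorm B s y delta phi tau : B^T = B ->
  0 <= phi <= 1 -> 0 < delta -> delta < 1 / 2 -> fnorm (B - 1%:M) <= 2 * delta ->
  s != 0 -> enorm (y - s) <= tau * enorm s -> tau < 1 ->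
  (phi + (1 - phi) * ((1 - 2 * delta) / (1 + 2 * delta)))
    * (enorm ((B - 1%:M) *m s) / enorm s) ^+ 2
  <= 4 * delta * (fnorm (B - 1%:M) - fnorm (broyden_update phi B s y - 1%:M)
     + (phi * (2 * delta + 1) * (4 / (1 - tau) ^+ 2) + (3 + tau) / (1 - tau)) * tau).
Proof.
move=> Bsym /andP[phi0 phi1] delta0 delta12 Edelta s0 ys tau1.
have sn0 : 0 < enorm s by rewrite enorm_gt0.
set u := (enorm s)^-1 *: s; set y' := (enorm s)^-1 *: y.
have sV0 : (enorm s)^-1 != 0 by rewrite invr_neq0 ?lt0r_neq0.
have uu : dotcv u u = 1.
  by rewrite dotcvZl dotcvZr -enorm_sqr; field; apply/lt0r_neq0.
have ytau : enorm (y' - u) <= tau.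
  rewrite -scalerBr enormZ ger0_norm ?invr_ge0 ?(ltW sn0) //.
  by rewrite mulrC ler_pdivrMr.
rewrite -(broyden_update_scale phi B s y _ sV0) -/u -/y'.
have -> : enorm ((B - 1%:M) *m s) / enorm s = enorm ((B - 1%:M) *m u).
  by rewrite -scalemxAr enormZ ger0_norm ?invr_ge0 ?(ltW sn0) // mulrC.
have tau0 : 0 <= tau by apply: le_trans (enorm_ge0 _) ytau.
have E_le v : enorm ((B - 1%:M) *m v) <= 2 * delta * enorm v.
  apply: le_trans (enorm_mulmx_le _ _) _.
  by rewrite ler_wpM2r ?enorm_ge0.
have BE v : B *m v = v + (B - 1%:M) *m v by rewrite mulmxBl mul1mx addrC subrK.
have B_le v : enorm (B *m v) <= (2 * delta + 1) * enorm v.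
  rewrite BE; apply: le_trans (ler_enormD _ _) _; have := E_le v; lra.
have B_itv v :
    (1 - 2 * delta) * dotcv v v <= dotcv v (B *m v) <= (1 + 2 * delta) * dotcv v v.
  rewrite BE dotcvDr; have := normr_dotcv_le v ((B - 1%:M) *m v).
  have : enorm v * enorm ((B - 1%:M) *m v) <= 2 * delta * dotcv v v.
    by have := ler_wpM2l (enorm_ge0 v) (E_le v); rewrite mulrCA -expr2 enorm_sqr.
  move=> h1 h2; have := le_trans h2 h1; rewrite ler_norml => /andP[h3 h4].
  by apply/andP; split; lra.
set p := fnorm (B - 1%:M) in Edelta *; set e := enorm _.
set W := (3 + tau) / (1 - tau) * tau.
have p0 : 0 <= p by apply: fnorm_ge0.
have e0 : 0 <= e by apply: enorm_ge0.
have drop c F : 0 <= F -> 0 <= c -> c * e ^+ 2 <= p ^+ 2 - F ^+ 2 ->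
    c * e ^+ 2 <= 4 * delta * (p - F).
  move=> F0 c0 h; have ce0 : 0 <= c * e ^+ 2 by rewrite mulr_ge0 ?sqr_ge0.
  have Fp : F <= p by rewrite -(@ler_pXn2r _ 2) ?nnegrE // -subr_ge0 (le_trans ce0).
  apply: le_trans h _; rewrite subr_sqr mulrC ler_wpM2r ?subr_ge0 //; lra.
have dDFP := DFP_update_fnorm B u Bsym uu.
have lo0 : 0 < 1 - 2 * delta by lra.
have hi0 : 0 < 1 + 2 * delta by lra.
have dBFGS := BFGS_update_fnorm B u _ _ Bsym uu lo0 B_itv.
set FD := fnorm (DFP_update B u u - 1%:M) in dDFP.
set FB := fnorm (BFGS_update B u u - 1%:M) in dBFGS.
have kappa0 : 0 <= (1 - 2 * delta) / (1 + 2 * delta) by rewrite divr_ge0 // ltW.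
have {}dDFP : 1 * e ^+ 2 <= 4 * delta * (p - FD).
  by apply: drop; rewrite ?fnorm_ge0 ?mul1r.
have {}dBFGS := drop _ _ (fnorm_ge0 _) kappa0 dBFGS.
set T := ((2 * delta + 1) * (4 / (1 - tau) ^+ 2)) * tau.
have pD : fnorm (DFP_update B u y' - DFP_update B u u) <= T + W.
  by rewrite /T /W -mulrDl; apply: DFP_update_perturb.
have pB := BFGS_update_perturb B u y' tau uu ytau tau1.
have F_le : fnorm (broyden_update phi B u y' - 1%:M) <=
    phi * (FD + (T + W)) + (1 - phi) * (FB + W).
  have -> : broyden_update phi B u y' - 1%:M
      = phi *: (DFP_update B u y' - 1%:M) + (1 - phi) *: (BFGS_update B u y' - 1%:M).
    by rewrite /broyden_update; apply/matrixP => i j; rewrite !mxE; ring.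
  apply: le_trans (ler_fnormD _ _) _; rewrite !fnormZ !ger0_norm ?subr_ge0 //.
  apply: lerD; rewrite ler_wpM2l ?subr_ge0 //.
    rewrite -(subrKA (DFP_update B u u)) addrC.
    by apply: le_trans (ler_fnormD _ _) (lerD _ _).
  rewrite -(subrKA (BFGS_update B u u)) addrC.
  by apply: le_trans (ler_fnormD _ _) (lerD _ _).
have hD := ler_wpM2l phi0 dDFP.
have phi1' : 0 <= 1 - phi by rewrite subr_ge0.
have hB := ler_wpM2l phi1' dBFGS.
have delta4 : 0 <= 4 * delta by lra.
have hF := ler_wpM2l delta4 F_le.
rewrite (_ : (phi * _ * _ + _) * tau = phi * T + W); last by rewrite /T /W; ring.
apply: le_trans (_ : phi * (4 * delta * (p - FD))
    + (1 - phi) * (4 * delta * (p - FB)) <= _).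
  apply: le_trans (lerD hD hB).
  by rewrite le_eqVlt; apply/orP; left; apply/eqP; ring.
rewrite -subr_ge0 in hF; rewrite -subr_ge0; apply: le_trans hF _.
 rewrite le_eqVlt; apply/orP; left; apply/eqP; ring.
Qed.

End BroydenUpdate.

(** * The iteration in normalized coordinates *)

Section NormalizedIteration.
Context {R : realType} {d : nat}.

Lemma near_id_coercive (B : 'M[R]_d) (c : R) (v : 'cV[R]_d) :
  fnorm (B - 1%:M) <= c -> (1 - c) * enorm v <= enorm (B *m v).
Proof.
move=> Bc; have -> : B *m v = v - (- ((B - 1%:M) *m v)).
  by rewrite opprK mulmxBl mul1mx addrC subrK.
have := ler_enormD (v - (- ((B - 1%:M) *m v))) (- ((B - 1%:M) *m v)).
rewrite subrK enormN; have := enorm_mulmx_le (B - 1%:M) v.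
have := ler_wpM2r (enorm_ge0 v) Bc; lra.
Qed.

(** Closeness to the identity, which the potential argument propagates along the
    iteration, is the source of the invertibility of the approximations. *)
Lemma near_id_unitmx (B : 'M[R]_d) (c : R) :
  fnorm (B - 1%:M) <= c -> c < 1 -> B \in unitmx.
Proof.
move=> Bc c1; rewrite -unitmx_tr -row_free_unit; apply: inj_row_free => v vB.
have /(congr1 trmx) := vB; rewrite trmx_mul trmxK trmx0 => BvT.
apply: trmx_inj; rewrite trmx0; apply/eqP; rewrite -enorm_eq0.
have := near_id_coercive B c v^T Bc; rewrite BvT enorm0.
have := enorm_ge0 v^T; rewrite le_eqVlt => /predU1P[<-//|v0].
by rewrite pmulr_lle0 // subr_le0 leNgt c1.
Qed.

Variables (r g : nat -> 'cV[R]_d) (B : nat -> 'M[R]_d) (phi : nat -> R).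
Variables (eps delta rho W q : R).
Hypothesis r_step : forall k, B k \in unitmx -> r k.+1 = r k - invmx (B k) *m g k.
Hypothesis B_step : forall k,
  B k.+1 = broyden_update (phi k) (B k) (r k.+1 - r k) (g k.+1 - g k).
Hypothesis r_neq : forall k, r k.+1 - r k != 0.
Hypothesis g_near : forall k, enorm (r k) <= 1 / 12 ->
  enorm (g k - r k) <= 2 * enorm (r k) ^+ 2.
Hypothesis y_near : forall k, enorm (r k) <= 1 / 12 ->
  enorm (r k.+1) <= enorm (r k) ->
  enorm ((g k.+1 - g k) - (r k.+1 - r k))
  <= 6 * enorm (r k) * enorm (r k.+1 - r k).
Hypothesis phi01 : forall k, 0 <= phi k <= 1.
Hypotheses (eps0 : 0 < eps) (eps12 : eps < 1 / 2).
Hypotheses (delta0 : 0 < delta) (delta12 : delta < 1 / 2).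
Hypotheses (rho0 : 0 < rho) (rho1 : rho < 1).
Hypothesis W_ge : forall k,
  phi k * (2 * delta + 1) * (4 / (1 - eps) ^+ 2) + (3 + eps) / (1 - eps) <= W.
Hypothesis W_le : W * (eps / (1 - rho)) <= delta.
Hypothesis rho_ge : eps / 3 + 2 * delta <= (1 - 2 * delta) * rho.
Hypothesis q0 : 0 <= q.
Hypothesis q_ge : forall k,
  1 <= q ^+ 2 * (phi k + (1 - phi k) * ((1 - 2 * delta) / (1 + 2 * delta))).
Hypothesis B0_sym : (B 0%N)^T = B 0%N.
Hypothesis B0_near : fnorm (B 0%N - 1%:M) <= delta.
Hypothesis r0_near : enorm (r 0%N) <= eps / 6.

Local Ltac bounds :=
  move: (eps0) (eps12) (delta0) (delta12) (rho0) (rho1) => ? ? ? ? ? ?.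

Let s k := r k.+1 - r k.

(** The Dennis-More quotient: a quasi-Newton method is superlinear when the error
    of [B k] becomes small along the steps, even if [B k] does not converge to
    the Hessian. *)
Let e k := enorm ((B k - 1%:M) *m s k) / enorm (s k).

(** The potential: the second summand pays for all the perturbations that the
    remaining steps can add to the Frobenius error, their sizes being dominated
    by a geometric series of ratio [rho]. *)
Let V k := fnorm (B k - 1%:M) + W * (6 * enorm (r k)) / (1 - rho).

Let invariant k := [/\ (B k)^T = B k, enorm (r k) <= eps / 6 & V k <= 2 * delta].

Lemma W_ge0 : 0 <= W.
Proof.
bounds.
apply: le_trans (W_ge 0); have /andP[phi0 _] := phi01 0.
have e1 : 0 <= 1 - eps by lra.
apply: addr_ge0; last by rewrite divr_ge0 //; lra.
rewrite mulr_ge0 ?divr_ge0 ?sqr_ge0 // mulr_ge0 //; lra.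
Qed.

Lemma invariant_fnorm k : invariant k -> fnorm (B k - 1%:M) <= 2 * delta.
Proof.
case=> _ _; apply: le_trans; rewrite lerDl divr_ge0 ?subr_ge0 ?(ltW rho1) //.
by rewrite mulr_ge0 ?W_ge0 // mulr_ge0 // enorm_ge0.
Qed.

(** [r_(k+1) = B^-1 ((B - I) r - (g - r))], where the two summands have norms at
    most [2 delta |r|] and [2 |r|^2 <= eps / 3 |r|], and [B^-1] has norm at most
    [1 / (1 - 2 delta)]. *)
Lemma linear_step k : invariant k -> enorm (r k.+1) <= rho * enorm (r k).
Proof.
bounds.
move=> Gk; have EB := invariant_fnorm k Gk; case: Gk => _ r_le _.
have d1 : 2 * delta < 1 by lra.
have Bu := near_id_unitmx _ _ EB d1.
have r12 : enorm (r k) <= 1 / 12 by lra.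
have r_ge0 := enorm_ge0 (r k).
have Br : B k *m r k.+1 = (B k - 1%:M) *m r k - (g k - r k).
  by rewrite r_step // mulmxBr mulKVmx // mulmxBl mul1mx opprB addrA subrK.
have := near_id_coercive _ _ (r k.+1) EB; rewrite Br.
have := ler_enormB ((B k - 1%:M) *m r k) (g k - r k).
have := enorm_mulmx_le (B k - 1%:M) (r k); have := ler_wpM2r r_ge0 EB.
have := g_near k r12; have := ler_wpM2l r_ge0 r_le.
have := ler_wpM2r r_ge0 rho_ge; rewrite -expr2 => h1 h2 h3 h4 h5 h6 h7.
have d2 : 0 < 1 - 2 * delta by lra.
rewrite -(ler_pM2l d2); lra.
Qed.

(** The second summand of [V] drops by at least [W * tau], with [tau = 6 |r_k|],
    because [|r|] shrinks by the factor [rho]; this is the largest increase of the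
    Frobenius error that the inexact secant pair can cause. *)
Lemma potential_step k : invariant k ->
  (phi k + (1 - phi k) * ((1 - 2 * delta) / (1 + 2 * delta))) * e k ^+ 2
  <= 4 * delta * (V k - V k.+1).
Proof.
bounds.
move=> Gk; have EB := invariant_fnorm k Gk; have lin := linear_step k Gk.
case: Gk => Bsym r_le _; have r_ge0 := enorm_ge0 (r k).
have r12 : enorm (r k) <= 1 / 12 by lra.
have rle1 : enorm (r k.+1) <= enorm (r k).
  by apply: le_trans lin _; rewrite ler_piMl // ltW.
set tau := 6 * enorm (r k).
have tau_eps : tau <= eps by rewrite /tau; lra.
have tau0 : 0 <= tau by rewrite /tau; lra.
have tau1 : tau < 1 by lra.
apply: le_trans (broyden_update_fnorm _ _ _ _ _ tau Bsym (phi01 k) delta0 delta12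
  EB (r_neq k) (y_near k r12 rle1) tau1) _.
rewrite -B_step ler_pM2l; last by lra.
rewrite /V -/tau opprD addrACA lerD2l.
have coefW : phi k * (2 * delta + 1) * (4 / (1 - tau) ^+ 2)
    + (3 + tau) / (1 - tau) <= W.
  apply: le_trans (W_ge k); have /andP[phi0 _] := phi01 k.
  have e1 : 0 < 1 - eps by lra.
  have t1 : 0 < 1 - tau by lra.
  apply: lerD; last first.
    by rewrite ler_pM ?invr_ge0 ?(ltW t1) ?lef_pV2 ?posrE //; lra.
  apply: ler_wpM2l; first by rewrite mulr_ge0 //; lra.
  rewrite ler_pM2l // lef_pV2 ?posrE ?exprn_gt0 //.
  rewrite ler_pXn2r ?nnegrE ?(ltW e1) ?(ltW t1) //.
  lra.
apply: le_trans (ler_wpM2r tau0 coefW) _.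
have rho1' : 0 < 1 - rho by lra.
rewrite -mulrBl -mulrBr ler_pdivlMr // -mulrA ler_wpM2l ?W_ge0 // /tau; lra.
Qed.

Lemma invariant_step k : invariant k -> invariant k.+1.
Proof.
bounds.
move=> Gk; have lin := linear_step k Gk; have pot := potential_step k Gk.
case: Gk => Bsym r_le V_le; split.
- by rewrite B_step broyden_update_tr.
- apply: le_trans lin _; apply: le_trans r_le.
  by rewrite ler_piMl ?enorm_ge0 // ltW.
- apply: le_trans V_le; rewrite -subr_ge0.
  have d4 : 0 < 4 * delta by lra.
  rewrite -(pmulr_rge0 _ d4); apply: le_trans pot.
  have /andP[phi0 phi1] := phi01 k.
  by rewrite mulr_ge0 ?sqr_ge0 // addr_ge0 // mulr_ge0 ?subr_ge0 // divr_ge0 //; lra.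
Qed.

Lemma invariant_all k : invariant k.
Proof.
bounds.
elim: k => [|k]; last exact: invariant_step.
split=> //; rewrite /V.
suff : W * (6 * enorm (r 0)) / (1 - rho) <= delta by have := B0_near; lra.
apply: le_trans W_le; rewrite [leRHS]mulrA ler_wpM2r ?invr_ge0 ?subr_ge0 ?(ltW rho1) //.
rewrite ler_wpM2l ?W_ge0 //; have := r0_near; lra.
Qed.

Lemma linear_rate k : enorm (r k) <= rho ^+ k * enorm (r 0%N).
Proof.
elim: k => [|k IH]; first by rewrite expr0 mul1r.
apply: le_trans (linear_step k (invariant_all k)) _.
by rewrite exprS -mulrA ler_wpM2l // ltW.
Qed.

(** The step [s] solves [B s = - g], that is, [(B - I) s = - r_(k+1) - (g - r)]:
    what is left after the step is the error of [B] along [s] and the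
    nonlinearity of the gradient. *)
Lemma superlinear_step k :
  enorm (r k.+1) <= ((1 + rho) * e k + 2 * enorm (r k)) * enorm (r k).
Proof.
bounds.
have Gk := invariant_all k; have EB := invariant_fnorm k Gk.
have lin := linear_step k Gk.
case: Gk => _ r_le _; have r12 : enorm (r k) <= 1 / 12 by lra.
have d1 : 2 * delta < 1 by lra.
have Bu := near_id_unitmx _ _ EB d1.
have -> : r k.+1 = - ((B k - 1%:M) *m s k) - (g k - r k).
  have Bs : B k *m s k = - g k.
    by rewrite /s r_step // addrAC subrr add0r mulmxN mulKVmx.
  by rewrite mulmxBl mul1mx Bs /s; apply/matrixP => i j; rewrite !mxE; ring.
apply: le_trans (ler_enormB _ _) _; rewrite enormN mulrDl.
apply: lerD; last by rewrite -mulrA -expr2 g_near.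
have s0 : 0 < enorm (s k) by rewrite enorm_gt0 r_neq.
have -> : enorm ((B k - 1%:M) *m s k) = e k * enorm (s k).
  by rewrite /e mulfVK // lt0r_neq0.
rewrite [leRHS]mulrAC [leRHS]mulrC ler_wpM2l //; first by rewrite divr_ge0 ?enorm_ge0.
apply: le_trans (ler_enormB _ _) _; lra.
Qed.

(** The potential starts at most at [2 delta] and stays nonnegative; the weights
    of the squares are at least [1 / q^2]. *)
Lemma sum_sqr_e_le k : \sum_(i < k) e i ^+ 2 <= q ^+ 2 * (8 * delta ^+ 2).
Proof.
bounds; have d4 : 0 <= 4 * delta by lra.
have step i : e i ^+ 2 <= q ^+ 2 * (4 * delta * (V i - V i.+1)).
  apply: le_trans (ler_wpM2l (sqr_ge0 q) (potential_step i (invariant_all i))).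
  by rewrite [leRHS]mulrA ler_peMl ?sqr_ge0.
apply: le_trans (ler_sum _ (fun (i : 'I_k) _ => step i)) _.
rewrite -mulr_sumr ler_wpM2l ?sqr_ge0 // -mulr_sumr.
rewrite -(big_mkord predT (fun i => V i - V i.+1)).
have -> : \sum_(0 <= i < k) (V i - V i.+1) = V 0 - V k.
  under eq_bigr do rewrite -opprB.
  by rewrite sumrN telescope_sumr // opprB.
have Vk0 : 0 <= V k.
  rewrite addr_ge0 ?fnorm_ge0 // divr_ge0 ?subr_ge0 ?(ltW rho1) //.
  by rewrite mulr_ge0 ?W_ge0 // mulr_ge0 // enorm_ge0.
have -> : 8 * delta ^+ 2 = 4 * delta * (2 * delta) by ring.
rewrite ler_wpM2l //; case: (invariant_all 0) => _ _; lra.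
Qed.

Lemma sum_e_le k :
  \sum_(i < k) e i <= 2 * Num.sqrt 2 * delta * q * Num.sqrt k%:R.
Proof.
have := cauchy_schwarz_sum (fun i : 'I_k => e i) (fun=> 1).
under eq_bigr do rewrite mulr1; move=> /le_trans; apply.
rewrite expr1n sumr_const card_ord ler_wpM2r ?sqrtr_ge0 //.
apply: le_trans (ler_wsqrtr (sum_sqr_e_le k)) _.
rewrite -[leRHS]ger0_norm; last first.
  by rewrite !mulr_ge0 ?sqrtr_ge0 // ltW.
rewrite -sqrtr_sqr ler_wsqrtr // !exprMn sqr_sqrtr // le_eqVlt.
by apply/orP; left; apply/eqP; ring.
Qed.

Lemma sum_r_le k : \sum_(i < k) enorm (r i) <= eps / (6 * (1 - rho)).
Proof.
bounds; have rho1' : 0 < 1 - rho by lra.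
have step i : (1 - rho) * enorm (r i) <= enorm (r i) - enorm (r i.+1).
  have := linear_step i (invariant_all i); lra.
rewrite invfM mulrA ler_pdivlMr // mulrC mulr_sumr.
apply: le_trans (ler_sum _ (fun (i : 'I_k) _ => step i)) _.
rewrite -(big_mkord predT (fun i => enorm (r i) - enorm (r i.+1))).
have -> : \sum_(0 <= i < k) (enorm (r i) - enorm (r i.+1))
    = enorm (r 0%N) - enorm (r k).
  under eq_bigr do rewrite -opprB.
  by rewrite sumrN telescope_sumr // opprB.
have := enorm_ge0 (r k); have := r0_near; lra.
Qed.

(** The first [k] factors of [superlinear_step] have a sum of order [sqrt k], by
    the Cauchy-Schwarz inequality for the [e i], and their product is at most
    the [k]-th power of their mean. *)
Lemma superlinear_rate k :
  enorm (r k) <= ((2 * Num.sqrt 2 * delta * (1 + rho) * q * Num.sqrt k%:R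
                   + eps / (3 * (1 - rho))) / k%:R) ^+ k * enorm (r 0%N).
Proof.
bounds; pose a i := (1 + rho) * e i + 2 * enorm (r i).
have a0 i : 0 <= a i.
  rewrite addr_ge0 ?mulr_ge0 ?enorm_ge0 //; first lra.
  by rewrite invr_ge0 enorm_ge0.
have prod_le : enorm (r k) <= (\prod_(i < k) a i) * enorm (r 0%N).
  elim: k => [|k IH]; first by rewrite big_ord0 mul1r.
  rewrite big_ord_recr /= mulrAC; apply: le_trans (superlinear_step k) _.
  by rewrite -/(a k) mulrC ler_wpM2r.
apply: le_trans prod_le _; rewrite ler_wpM2r ?enorm_ge0 //.
have := (leif_AGM (A := {: 'I_k}) (E := fun i => a i) (fun i _ => a0 i)).
rewrite cardE size_enum_ord => /leif_le /le_trans; apply.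
apply: lerXn2r; rewrite ?nnegrE.
- by rewrite mulr_ge0 ?invr_ge0 // sumr_ge0.
- by rewrite mulr_ge0 ?invr_ge0 // addr_ge0 ?divr_ge0 ?mulr_ge0 ?sqrtr_ge0 //; lra.
rewrite ler_wpM2r ?invr_ge0 // big_split /= -!mulr_sumr.
apply: lerD.
  apply: le_trans (ler_wpM2l _ (sum_e_le k)) _; first lra.
  by rewrite le_eqVlt; apply/orP; left; apply/eqP; ring.
apply: le_trans (ler_wpM2l _ (sum_r_le k)) _ => //.
rewrite le_eqVlt; apply/orP; left; apply/eqP; field.
by rewrite lt0r_neq0 // subr_gt0.
Qed.

End NormalizedIteration.

(** * Positive definite matrices *)

Section PositiveDefinite.
Context {R : realType}.

Lemma poly_interpolation (F : R -> R) (s : seq R) :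
  exists p : {poly R}, forall x, x \in s -> p.[x] = F x.
Proof.
elim: s => [|a s [p IH]]; first by exists 0.
have [a_s|a_s] := boolP (a \in s).
  by exists p => x; rewrite in_cons => /predU1P[->|]; apply: IH.
pose m := \prod_(b <- s) ('X - b%:P).
have m_root x : (m.[x] == 0) = (x \in s) by have := root_prod_XsubC s x.
exists (p + ((F a - p.[a]) / m.[a]) *: m) => x.
rewrite hornerD hornerZ in_cons => /predU1P[->|xs].
  by rewrite divfK ?m_root // addrC subrK.
by rewrite (eqP (_ : m.[x] == 0)) ?m_root // mulr0 addr0 IH.
Qed.

(** A symmetric matrix is diagonalizable over the complex numbers, and its
    eigenvalues are real; hence a real polynomial that vanishes on the spectrum
    annihilates the matrix.  In this form the spectral theorem gives functions of
    [A] without leaving the real numbers. *)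
Lemma symmetric_horner_mx {n} (A : 'M[R]_n.+1) : A^T = A ->
  exists2 s : seq R, {in s, forall x, eigenvalue A x} &
    forall p : {poly R}, all (root p) s -> horner_mx A p = 0.
Proof.
move=> Asym; pose f : {rmorphism R -> R[i]} := real_complex R.
have f_inj : injective f by apply: complexI.
have f_real x : f x \is Num.real by apply/Creal_ImP; rewrite -complexIm.
pose AC := map_mx f A.
have ACherm : AC \is hermsymmx.
  apply: realsym_hermsym; last by apply/mxOverP => i j; rewrite mxE.
  apply/is_hermitianmxP; rewrite expr0 scale1r map_mx_id //.
  by apply/matrixP => i j; rewrite !mxE -[in LHS]Asym mxE.
have [P [D [Pu D_real AC_eq]]] : exists P D,
    [/\ P \in unitmx, D \is a mxOver Num.real & AC = invmx P *m diag_mx D *m P].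
  exists (spectralmx AC), (spectral_diag AC); split; first exact: spectral_unit.
    exact: hermitian_spectral_diag_real.
  exact/orthomx_spectralP/hermitian_normalmx.
pose lam j : R := complex.Re (D 0 j).
have lamE j : f (lam j) = D 0 j.
  have /mxOverP /(_ 0 j) /complex_realP[x Dx] := D_real.
  by rewrite /lam Dx.
exists [seq lam j | j <- enum 'I_n.+1].
  move=> _ /mapP[j _ ->]; rewrite eigenvalue_root_char.
  rewrite -(fmorph_root f) map_char_poly -eigenvalue_root_char lamE.
  apply/eigenvalueP; exists (row j P).
    rewrite -row_mul -/AC AC_eq !mulmxA mulmxV // mul1mx.
    by apply/matrixP => i k; rewrite mul_diag_mx !mxE.
  apply/eqP => /(congr1 (mulmx^~ (invmx P))).
  rewrite mul0mx rowE mulmxK // => /matrixP /(_ 0 j).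
  by rewrite !mxE !eqxx => /eqP; rewrite oner_eq0.
move=> p /allP p_root; apply: (map_mx_inj (f := f)).
rewrite map_horner_mx map_mx0 -/AC AC_eq.
have -> := @horner_mx_uconjC _ n (map_poly f p) P (diag_mx D) Pu.
rewrite horner_mx_diag.
suff -> : map_mx (horner (map_poly f p)) D = 0.
  by rewrite (_ : diag_mx 0 = 0) ?mulmx0 ?mul0mx //; apply: linear0.
apply/matrixP => i j; rewrite (ord1 i) !mxE -lamE horner_map.
have /eqP -> : root p (lam j) by apply: p_root; apply: map_f; rewrite mem_enum.
by rewrite rmorph0.
Qed.

Lemma posdefmx_eigenvalue {n} (A : 'M[R]_n) (a : R) :
  posdefmx A -> eigenvalue A a -> 0 < a.
Proof.
case=> Asym Apos /eigenvalueP[v vA v0].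
have vT0 : v^T != 0 by rewrite trmx_eq0.
have := Apos _ vT0; have -> : A *m v^T = a *: v^T.
  by rewrite -{1}Asym -trmx_mul vA; apply: linearZ.
by rewrite dotcvZr pmulr_lgt0 // -enorm_sqr exprn_gt0 // enorm_gt0.
Qed.

(** The square root is [T *m T] with [T] a polynomial in [A] that takes the value
    [a ^ (1/4)] at the eigenvalues [a]: taking the fourth root makes [T *m T]
    visibly positive. *)
Lemma posdefmx_sqrt_ex {n} (A : 'M[R]_n) : posdefmx A ->
  exists S : 'M[R]_n, posdefmx S /\ S *m S = A.
Proof.
case: n A => [|n] A Apos.
  exists 0; split; [split=> [|v] |]; rewrite ?trmx0 ?[v]flatmx0 ?eqxx //.
  by rewrite [A]flatmx0 [LHS]flatmx0.
have [Asym Apd] := Apos.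
have [s s_eig s_annul] := symmetric_horner_mx A Asym.
have [p p_s] := poly_interpolation (fun x => Num.sqrt (Num.sqrt x)) s.
pose T := horner_mx A p.
have T4 : (T *m T) *m (T *m T) = A.
  have /eqP : horner_mx A (p * p * (p * p) - 'X) = 0.
    apply: s_annul; apply/allP => x xs; rewrite /root.
    rewrite hornerD hornerN hornerX !hornerM p_s //.
    have x0 : 0 < x by apply: posdefmx_eigenvalue Apos (s_eig x xs).
    by rewrite -!expr2 !sqr_sqrtr ?sqrtr_ge0 ?(ltW x0) // subrr.
  by rewrite rmorphB /= !rmorphM /= horner_mx_X subr_eq0 => /eqP.
have Tsym : T^T = T.
  have Xs q : (horner_mx A q)^T = horner_mx A q.
    elim/poly_ind: q => [|q c IH]; first by rewrite rmorph0 trmx0.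
    rewrite rmorphD rmorphM /= horner_mx_X horner_mx_C trmxD trmx_mul IH Asym.
    rewrite tr_scalar_mx; congr (_ + _).
    by have := comm_horner_mx q (erefl : comm_mx A A).
  exact: Xs.
exists (T *m T); split=> //; split=> [|v v0]; first by rewrite trmx_mul Tsym.
rewrite -mulmxA -{1}Tsym -dotcv_mull -enorm_sqr exprn_gt0 // enorm_gt0.
apply: contra_neq v0 => Tv; apply/eqP; apply: contraT => v0.
by have := Apd v v0; rewrite -T4 -!mulmxA Tv !mulmx0 dotcv0r ltxx.
Qed.

Lemma sqrtmxP {n} (A : 'M[R]_n) : posdefmx A ->
  posdefmx (sqrtmx A) /\ sqrtmx A *m sqrtmx A = A.
Proof.
move=> /posdefmx_sqrt_ex[S SA].
by rewrite /sqrtmx; case: xgetP => [_ -> //|/(_ S)].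
Qed.

Lemma posdefmx_unit {n} (A : 'M[R]_n) : posdefmx A -> A \in unitmx.
Proof.
case=> Asym Apos; rewrite -unitmx_tr -row_free_unit; apply: inj_row_free => v vA.
have /(congr1 trmx) := vA; rewrite trmx_mul trmxK trmx0 => AvT.
apply: trmx_inj; rewrite trmx0; apply/eqP; apply: contraT => /Apos.
by rewrite AvT dotcv0r ltxx.
Qed.

Lemma posdefmx_inv {n} (A : 'M[R]_n) : posdefmx A -> posdefmx (invmx A).
Proof.
move=> Apd; have Au := posdefmx_unit A Apd; case: Apd => Asym Apos.
split=> [|v v0]; first by rewrite trmx_inv Asym.
rewrite -{1}(mulKVmx Au v) dotcv_mull Asym.
have : invmx A *m v != 0.
  by apply: contra_neq v0 => Av; rewrite -(mulKVmx Au v) Av mulmx0.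
exact: Apos.
Qed.

(** Polarization, after scaling [v] and [w] to the same [H]-norm. *)
Lemma form_polarization {n} (H M : 'M[R]_n) (a : R) (v w : 'cV[R]_n) :
  posdefmx H -> M^T = M ->
  (forall u, `|dotcv u (M *m u)| <= a * dotcv u (H *m u)) ->
  dotcv v (M *m w)
  <= a * (Num.sqrt (dotcv v (H *m v)) * Num.sqrt (dotcv w (H *m w))).
Proof.
move=> [Hsym Hpos] Msym Ma.
have Hadj u u' : dotcv u (H *m u') = dotcv u' (H *m u).
  by rewrite dotcvC dotcv_mull Hsym.
have Madj u u' : dotcv u (M *m u') = dotcv u' (M *m u).
  by rewrite dotcvC dotcv_mull Msym.
have [->|/Hpos v0] := eqVneq v 0; first by rewrite !dotcv0l sqrtr0 mul0r mulr0.
have [->|/Hpos w0] := eqVneq w 0.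
  by rewrite mulmx0 dotcv0r mulmx0 dotcv0r sqrtr0 !mulr0.
set nv := Num.sqrt _; set nw := Num.sqrt _.
have nv0 : 0 < nv by rewrite sqrtr_gt0.
have nw0 : 0 < nw by rewrite sqrtr_gt0.
have nv2 : dotcv v (H *m v) = nv ^+ 2 by rewrite sqr_sqrtr ?ltW.
have nw2 : dotcv w (H *m w) = nw ^+ 2 by rewrite sqr_sqrtr ?ltW.
have := Ma (nw *: v + nv *: w); have := Ma (nw *: v - nv *: w).
rewrite !mulmxDr !mulmxN -!scalemxAr !dotcv_lin (Madj w v) (Hadj w v) nv2 nw2.
set m := dotcv v (M *m w); rewrite !ler_norml => /andP[h1 _] /andP[_ h2].
rewrite -(ler_pM2l (mulr_gt0 nv0 nw0)); lra.
Qed.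

(** The form of [K - H] lies between [(b - 1)] and [(1 / b - 1)] times that of [H],
    and [1 - b <= 1 / b - 1]. *)
Lemma form_comparison {n} (H K : 'M[R]_n) (b : R) (v w : 'cV[R]_n) :
  posdefmx H -> posdefmx K -> 0 < b <= 1 ->
  (forall u, b * dotcv u (H *m u) <= dotcv u (K *m u) <= dotcv u (H *m u) / b) ->
  dotcv v (K *m w) - dotcv v (H *m w)
  <= (b^-1 - 1) * (Num.sqrt (dotcv v (H *m v)) * Num.sqrt (dotcv w (H *m w))).
Proof.
move=> Hpd Kpd /andP[b0 b1] HK; rewrite -dotcvBr -mulmxBl.
apply: form_polarization => //.
  by rewrite trmxD trmxN; case: Hpd Kpd => -> _ [-> _].
move=> u; have /andP[lo up] := HK u; rewrite mulmxBl dotcvBr.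
have H0 : 0 <= dotcv u (H *m u).
  by have [->|/Hpd.2/ltW//] := eqVneq u 0; rewrite dotcv0l.
have bb : 1 - b <= b^-1 - 1.
  rewrite -subr_ge0 (_ : _ - _ = (1 - b) ^+ 2 / b); last by field; apply/lt0r_neq0.
  by rewrite divr_ge0 ?sqr_ge0 // ltW.
by have := ler_wpM2r H0 bb; rewrite ler_norml => hb; apply/andP; split; lra.
Qed.

End PositiveDefinite.

(** * Comparison of derivatives on an interval *)

Section ScalarCalculus.
Context {R : realType}.
Implicit Types (F G : R -> R) (t T : R).

Lemma is_derive_mul F G t dF dG : is_derive t 1 F dF -> is_derive t 1 G dG ->
  is_derive t 1 (fun u => F u * G u) (dF * G t + F t * dG).
Proof.
move=> HF HG; have := @is_deriveM _ _ F G t 1 dF dG HF HG.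
by rewrite /GRing.scale /= addrC (mulrC (G t)).
Qed.

Lemma is_derive_sub F G t dF dG : is_derive t 1 F dF -> is_derive t 1 G dG ->
  is_derive t 1 (fun u => F u - G u) (dF - dG).
Proof. by move=> HF HG; have := @is_deriveB _ _ _ F G t 1 dF dG HF HG. Qed.

Lemma is_derive_affine (a b t : R) : is_derive t 1 (fun u => a + u * b) b.
Proof.
have dM := is_derive_mul id (cst b) t 1 0 (is_derive_id t 1) (is_derive_cst b t 1).
have := @is_deriveD _ _ _ (cst a) _ t 1 0 _ (is_derive_cst a t 1) dM.
by rewrite add0r mul1r mulr0 addr0.
Qed.

(** Comparison of increments: the form of the mean value theorem from which all
    the estimates along a segment follow. *)
Lemma le_increment F G (F' G' : R -> R) T : 0 <= T ->
  (forall t, 0 <= t <= T -> is_derive t 1 F (F' t)) ->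
  (forall t, 0 <= t <= T -> is_derive t 1 G (G' t)) ->
  (forall t, 0 <= t <= T -> F' t <= G' t) -> F T - F 0 <= G T - G 0.
Proof.
move=> T0 dF dG FG.
have dH t : 0 <= t <= T -> is_derive t 1 (fun u => G u - F u) (G' t - F' t).
  by move=> tT; apply: is_derive_sub; [exact: dG|exact: dF].
have dH_oo t : t \in `]0, T[%R ->
    is_derive t 1 (fun u => G u - F u) (G' t - F' t).
  by rewrite in_itv /= => /andP[t0 tT]; apply: dH; rewrite !ltW.
have H_cont : {within `[0, T], continuous (fun u => G u - F u)}.
  apply: derivable_within_continuous => t; rewrite in_itv /= => tT.
  exact: (@ex_derive _ _ _ _ _ _ _ (dH t tT)).
have [c] := @MVT_segment R _ (fun u => G' u - F' u) 0 T T0 dH_oo H_cont.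
rewrite in_itv /= subr0 => /FG FGc eqc; rewrite -subr_ge0.
have -> : G T - G 0 - (F T - F 0) = G T - F T - (G 0 - F 0) by ring.
by rewrite eqc mulr_ge0 // subr_ge0.
Qed.

(** The differential inequality of self-concordance along a line means that the
    derivative of [h ^ (- 1/2)] is at least [- 1]. *)
Lemma sc_sqrt_bound (h h' : R -> R) (sigma T : R) : 0 <= T ->
  (forall t, 0 <= t <= T -> is_derive t 1 h (h' t)) ->
  (forall t, 0 <= t <= T -> 0 < h t) ->
  (forall t, 0 <= t <= T -> h' t <= 2 * Num.sqrt (h t) * h t) ->
  0 < sigma -> h 0 = sigma ^+ 2 ->
  Num.sqrt (h T) * (1 - T * sigma) <= sigma.
Proof.
move=> T0 dh h0 h'_le sigma0 h_0.
pose N t := (Num.sqrt (h t))^-1.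
pose N' t := - (Num.sqrt (h t)) ^- 2 * ((2 * Num.sqrt (h t))^-1 * h' t).
have TT : 0 <= T <= T by rewrite T0 lexx.
have s0 t : 0 <= t <= T -> 0 < Num.sqrt (h t) by move=> /h0; rewrite sqrtr_gt0.
have dN t : 0 <= t <= T -> is_derive t 1 N (N' t).
  move=> tT; apply: is_deriveV; first exact/lt0r_neq0/s0.
  have dsq := is_derive1_sqrt (h0 t tT).
  exact: (@is_derive1_comp _ Num.sqrt h t _ _ dsq (dh t tT)).
have := le_increment (fun t => 0 + t * -1) N (fun=> -1) N' T T0
  (fun t _ => is_derive_affine 0 (-1) t) dN.
have N'_ge t : 0 <= t <= T -> -1 <= N' t.
  move=> tT; have st := s0 t tT; rewrite /N' mulNr lerN2.
  have -> : Num.sqrt (h t) ^- 2 * ((2 * Num.sqrt (h t))^-1 * h' t)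
      = h' t / (2 * Num.sqrt (h t) * h t).
    rewrite -[X in _ = _ / (_ * X)](sqr_sqrtr (ltW (h0 t tT))).
    by field; rewrite lt0r_neq0.
  by rewrite ler_pdivrMr ?mul1r ?h'_le // mulr_gt0 ?h0 // mulr_gt0.
move=> /(_ N'_ge); rewrite /N h_0 sqrtr_sqr gtr0_norm // => NT.
have sT := s0 T TT.
rewrite -ler_pdivlMl // -[leRHS]mulr1.
have : (sigma^-1 - T) * sigma <= (Num.sqrt (h T))^-1 * sigma.
  by rewrite ler_wpM2r ?(ltW sigma0) //; lra.
by rewrite mulrBl mulVf ?lt0r_neq0 // mulr1.
Qed.

(** [(1 - t sigma)^2 p(t)] is nonincreasing and [p(t) / (1 - t sigma)^2] is
    nondecreasing. *)
Lemma sc_form_bound (p p' k : R -> R) (sigma : R) : 0 <= sigma < 1 ->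
  (forall t, 0 <= t <= 1 -> is_derive t 1 p (p' t)) ->
  (forall t, 0 <= t <= 1 -> 0 <= p t) ->
  (forall t, 0 <= t <= 1 -> `|p' t| <= 2 * k t * p t) ->
  (forall t, 0 <= t <= 1 -> k t * (1 - t * sigma) <= sigma) ->
  forall t, 0 <= t <= 1 ->
  (1 - t * sigma) ^+ 2 * p 0 <= p t <= p 0 / (1 - t * sigma) ^+ 2.
Proof.
move=> /andP[sigma0 sigma1] dp p0 p'_le k_le T /andP[T0 T1].
have sub t : 0 <= t <= T -> 0 <= t <= 1.
  by move=> /andP[-> tT]; apply: le_trans tT T1.
have a0 t : 0 <= t <= T -> 0 < 1 - t * sigma.
  move=> /sub/andP[t0 t1]; rewrite subr_gt0; apply: le_lt_trans sigma1.
  by rewrite ler_piMl.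
have TT : 0 <= T <= T by rewrite T0 lexx.
pose a t := 1 + t * - sigma.
have aE t : a t = 1 - t * sigma by rewrite /a mulrN.
have da t : is_derive t 1 a (- sigma) by apply: is_derive_affine.
have daa t : is_derive t 1 (fun u => a u * a u) (- sigma * a t + a t * - sigma).
  exact: is_derive_mul.
have dz t : is_derive t 1 (fun=> 0 : R) 0 by apply: is_derive_cst.
have key t : 0 <= t <= T -> `|p' t| * a t <= 2 * sigma * p t.
  move=> tT; have at0 := a0 t tT; rewrite aE.
  apply: le_trans (ler_wpM2r (ltW at0) (p'_le t (sub t tT))) _.
  have := ler_wpM2r (p0 t (sub t tT)) (k_le t (sub t tT)); lra.
have up : p T * (a T * a T) - p 0 * (a 0 * a 0) <= 0 - 0.
  apply: (le_increment (fun u => p u * (a u * a u)) (fun=> 0)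
    (fun t => p' t * (a t * a t) + p t * (- sigma * a t + a t * - sigma)) (fun=> 0))
    => // t tT.
    exact: (is_derive_mul p _ t _ _ (dp t (sub t tT)) (daa t)).
  have at0 := a0 t tT; rewrite -aE in at0.
  have := ler_wpM2r (ltW at0) (key t tT).
  have := ler_wpM2r (ltW at0) (ler_wpM2r (ltW at0) (ler_norm (p' t))); lra.
have lo : 0 - 0 <= p T * (a T * a T)^-1 - p 0 * (a 0 * a 0)^-1.
  apply: (le_increment (fun=> 0) (fun u => p u * (a u * a u)^-1) (fun=> 0)
    (fun t => p' t * (a t * a t)^-1
      + p t * (- (a t * a t) ^- 2 * (- sigma * a t + a t * - sigma)))) => // t tT.
    have aat0 : a t * a t != 0.
      by have := a0 t tT; rewrite -aE => at0; rewrite mulf_neq0 ?lt0r_neq0.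
    have dV := @is_deriveV _ (fun u => a u * a u) t _ _ aat0 (daa t).
    exact: (is_derive_mul p _ t _ _ (dp t (sub t tT)) dV).
  have at0 := a0 t tT; rewrite -aE in at0.
  have -> : p' t * (a t * a t)^-1
      + p t * (- (a t * a t) ^- 2 * (- sigma * a t + a t * - sigma))
    = (p' t * a t + 2 * sigma * p t) / a t ^+ 3 by field; apply/lt0r_neq0.
  rewrite divr_ge0 ?exprn_ge0 ?(ltW at0) //.
  have := ler_norm (- p' t); rewrite normrN => /(ler_wpM2r (ltW at0)).
  have := key t tT; lra.
have aT0 := a0 T TT; have a0E : a 0 = 1 by rewrite /a mul0r addr0.
move: up lo; rewrite a0E !mulr1 invr1 mulr1 aE -expr2 !subr0 => up lo.
apply/andP; split; last first.
  by rewrite ler_pdivlMr ?exprn_gt0 // -subr_le0.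
by rewrite mulrC -ler_pdivlMr ?exprn_gt0 // -subr_ge0.
Qed.

End ScalarCalculus.

(** * Self-concordant functions along segments *)

Section Segment.
Context {R : realType} {d : nat}.
Implicit Types (x r v w : 'cV[R]_d).

Lemma is_derive_line (g : 'cV[R]_d -> R) x r t :
  differentiable g (x + t *: r) ->
  is_derive t 1 (fun u => g (x + u *: r)) ('D_r g (x + t *: r)).
Proof.
move=> /(@diff_derivable _ _ _ _ _ r) dg.
have lineE : (fun h : R => h^-1 *: (((fun u => g (x + u *: r)) \o shift t) (h *: 1)
                                - g (x + t *: r)))
    = (fun h => h^-1 *: ((g \o shift (x + t *: r)) (h *: r) - g (x + t *: r))).
  apply/funext => h /=; rewrite [h%:A]mulr1 scalerDl addrCA //.
by apply: DeriveDef; rewrite /derivable /derive lineE.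
Qed.

Lemma derive_coord (g : 'cV[R]_d -> R) x v : differentiable g x ->
  'D_v g x = \sum_i v i 0 * 'D_(delta_mx i 0) g x.
Proof.
move=> dg; rewrite deriveE // {1}(matrix_sum_delta v) linear_sum.
by apply: eq_bigr => i _; rewrite big_ord1 linearZ deriveE.
Qed.

Lemma deriveN_dir (g : 'cV[R]_d -> R) x v : differentiable g x ->
  'D_(- v) g x = - 'D_v g x.
Proof. by move=> dg; rewrite !deriveE // linearN. Qed.

Lemma is_derive_sumf n (h : 'I_n -> R -> R) (dh : 'I_n -> R) (t : R) :
  (forall i, is_derive t 1 (h i) (dh i)) ->
  is_derive t 1 (fun u => \sum_i h i u) (\sum_i dh i).
Proof.
move=> hd; have := @is_derive_sum _ _ _ n h t 1 dh hd.
by congr is_derive; apply/funext => u; rewrite fct_sumE.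
Qed.

Lemma is_derive_scale (c : R) (h : R -> R) (dh t : R) :
  is_derive t 1 h dh -> is_derive t 1 (fun u => c * h u) (c * dh).
Proof.
move=> hd; have := is_derive_mul (cst c) h t 0 dh (is_derive_cst c t 1) hd.
by rewrite mul0r add0r.
Qed.

Lemma is_derive_dotcv v (a : R -> 'cV[R]_d) (da : 'cV[R]_d) (t : R) :
  (forall i, is_derive t 1 (fun u => a u i 0) (da i 0)) ->
  is_derive t 1 (fun u => dotcv v (a u)) (dotcv v da).
Proof.
move=> ad; rewrite dotcvE; under eq_fun do rewrite dotcvE.
by apply: is_derive_sumf => i; apply: is_derive_scale.
Qed.

Lemma is_derive_mulmx (A : R -> 'M[R]_d) (dA : 'M[R]_d) v (t : R) :
  (forall i j, is_derive t 1 (fun u => A u i j) (dA i j)) ->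
  forall i, is_derive t 1 (fun u => (A u *m v) i 0) ((dA *m v) i 0).
Proof.
move=> Ad i; rewrite mxE; under eq_fun do rewrite mxE.
apply: is_derive_sumf => j; rewrite mulrC; under eq_fun do rewrite mulrC.
exact: is_derive_scale.
Qed.

Variables (D : set 'cV[R]_d) (f : 'cV[R]_d -> R).
Hypotheses (D_convex : convex_set D) (f_sc : self_concordant D f).

Lemma segment_dom x z t : D x -> D z -> 0 <= t <= 1 -> D (x + t *: (z - x)).
Proof.
move=> Dx Dz t01; pose l : {i01 R} := Itv01 (andP t01).1 (andP t01).2.
have -> : x + t *: (z - x) = t *: z + (1 - t) *: x.
  by apply/matrixP => i j; rewrite !mxE; ring.
exact: set_mem (D_convex z x l (mem_set Dz) (mem_set Dx)).
Qed.

Lemma sc_diff1 z : D z -> differentiable f z.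
Proof. by case: f_sc => -[d1 _] _ _; apply: d1. Qed.

Lemma sc_diff2 v z : D z -> differentiable (fun y => 'D_v f y) z.
Proof. by case: f_sc => -[_ /(_ v)[d2 _]] _ _; apply: d2. Qed.

Lemma sc_diff3 v w z : D z ->
  differentiable (fun y => 'D_w (fun y' => 'D_v f y') y) z.
Proof. by case: f_sc => -[_ /(_ v)[_ /(_ w)[d3 _]]] _ _; apply: d3. Qed.

Lemma sc_posdef z : D z -> posdefmx (hessian f z).
Proof. by case: f_sc => _ + _; apply. Qed.

Lemma derive_gradient v z : D z -> 'D_v f z = dotcv (gradient f z) v.
Proof.
move=> Dz; rewrite derive_coord; last exact: sc_diff1.
by rewrite dotcvC dotcvE; apply: eq_bigr => i _; rewrite mxE.
Qed.

Lemma is_derive_gradient_line v x r t : D (x + t *: r) ->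
  is_derive t 1 (fun u => dotcv v (gradient f (x + u *: r)))
    (dotcv v (hessian f (x + t *: r) *m r)).
Proof.
move=> Dt; apply: is_derive_dotcv => i.
have -> : (hessian f (x + t *: r) *m r) i 0
    = 'D_r (fun z => 'D_(delta_mx i 0) f z) (x + t *: r).
  rewrite derive_coord; last exact: sc_diff2.
  by rewrite mxE; apply: eq_bigr => j _; rewrite mxE mulrC.
under eq_fun do rewrite mxE.
by apply: (@is_derive_line (fun z => 'D_(delta_mx i 0) f z)); apply: sc_diff2.
Qed.

Definition hessian_deriv z r : 'M[R]_d :=
  \matrix_(i, j) 'D_r (fun y => hessian f y i j) z.

Lemma hessian_entryE i j : (fun y => hessian f y i j) =
  (fun y => 'D_(delta_mx j 0) (fun z => 'D_(delta_mx i 0) f z) y).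
Proof. by apply/funext => y; rewrite mxE. Qed.

Lemma is_derive_hessian_line x r t i j : D (x + t *: r) ->
  is_derive t 1 (fun u => hessian f (x + u *: r) i j)
    (hessian_deriv (x + t *: r) r i j).
Proof.
move=> Dt; rewrite mxE; apply: (@is_derive_line (fun z => hessian f z i j)).
by rewrite hessian_entryE; apply: sc_diff3.
Qed.

Lemma hessian_derivE z r : D z ->
  derive1 (fun t : R => hessian f (z + t *: r)) 0 = hessian_deriv z r.
Proof.
move=> Dz; have Dz0 : D (z + 0 *: r) by rewrite scale0r addr0.
have dH i j := is_derive_hessian_line z r 0 i j Dz0.
rewrite derive1E derive_mx.
  have -> : hessian_deriv z r = hessian_deriv (z + 0 *: r) r.
    by rewrite scale0r addr0.
  apply/matrixP => i j; rewrite [LHS]mxE.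
  exact: (@derive_val _ _ _ _ _ _ _ (dH i j)).
by apply/derivable_mxP => i j; exact: (@ex_derive _ _ _ _ _ _ _ (dH i j)).
Qed.

(** The one-sided matrix inequality holds for the directions [r] and [- r], where
    the derivative takes opposite values. *)
Lemma sc_ineq z r v : D z ->
  `|dotcv v (hessian_deriv z r *m v)|
  <= 2 * Num.sqrt (dotcv r (hessian f z *m r)) * dotcv v (hessian f z *m v).
Proof.
move=> Dz.
have up r' : dotcv v (hessian_deriv z r' *m v)
    <= 2 * Num.sqrt (dotcv r' (hessian f z *m r')) * dotcv v (hessian f z *m v).
  case: f_sc => _ _ /(_ z r' Dz)[_ /(_ v)].
  by rewrite hessian_derivE // mulmxBl dotcvBr -scalemxAl dotcvZr subr_ge0.
have dN : hessian_deriv z (- r) = - hessian_deriv z r.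
  apply/matrixP => i j; rewrite [LHS]mxE [RHS]mxE [in RHS]mxE.
  by apply: deriveN_dir; rewrite hessian_entryE; apply: sc_diff3.
rewrite ler_norml up andbT lerNl; have := up (- r).
by rewrite dN mulNmx mulmxN dotcvNl !dotcvNr opprK.
Qed.

(** The local norm at [z] of the theory of self-concordant functions. *)
Definition hnorm z v : R := Num.sqrt (dotcv v (hessian f z *m v)).

Lemma hform_ge0 z v : D z -> 0 <= dotcv v (hessian f z *m v).
Proof.
move=> Dz; have [_ Hpos] := sc_posdef z Dz.
by have [->|/Hpos/ltW//] := eqVneq v 0; rewrite dotcv0l.
Qed.

Lemma hnorm_sqr z v : D z -> hnorm z v ^+ 2 = dotcv v (hessian f z *m v).
Proof. by move=> Dz; rewrite sqr_sqrtr // hform_ge0. Qed.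

(** With [v] the direction of the segment, the differential inequality of
    self-concordance involves a single function and can be solved; the solution
    turns the inequality for an arbitrary [v] into a linear one. *)
Lemma sc_hessian_segment x z t v : D x -> D z -> hnorm x (z - x) < 1 ->
  0 <= t <= 1 ->
  (1 - t * hnorm x (z - x)) ^+ 2 * dotcv v (hessian f x *m v)
  <= dotcv v (hessian f (x + t *: (z - x)) *m v)
  <= dotcv v (hessian f x *m v) / (1 - t * hnorm x (z - x)) ^+ 2.
Proof.
move=> Dx Dz; set r := z - x; set sigma := hnorm x r => sigma1 t01.
have Dt (u : R) : 0 <= u <= 1 -> D (x + u *: r) by apply: segment_dom.
have sigma0 : 0 <= sigma by apply: sqrtr_ge0.
have dform w (u : R) : 0 <= u <= 1 ->
    is_derive u 1 (fun u => dotcv w (hessian f (x + u *: r) *m w))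
      (dotcv w (hessian_deriv (x + u *: r) r *m w)).
  move=> /Dt Du; apply/is_derive_dotcv/is_derive_mulmx => i j.
  exact: is_derive_hessian_line.
pose p w (u : R) := dotcv w (hessian f (x + u *: r) *m w).
pose k u := Num.sqrt (p r u).
have p0 w : p w 0 = dotcv w (hessian f x *m w) by rewrite /p scale0r addr0.
have k_le (u : R) : 0 <= u <= 1 -> k u * (1 - u * sigma) <= sigma.
  move=> /andP[u0 u1]; have [r0|r0] := eqVneq r 0.
    by rewrite /k /p r0 dotcv0l sqrtr0 mul0r.
  have sub (s : R) : 0 <= s <= u -> 0 <= s <= 1.
    by move=> /andP[-> su]; apply: le_trans su u1.
  apply: (sc_sqrt_bound (p r)
    (fun s => dotcv r (hessian_deriv (x + s *: r) r *m r))) => //.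
  - by move=> s /sub; apply: dform.
  - by move=> s /sub/Dt/sc_posdef[_]; apply.
  - by move=> s /sub/Dt Ds; apply: le_trans (ler_norm _) (sc_ineq _ _ _ Ds).
  - by rewrite sqrtr_gt0; have [_] := sc_posdef x Dx; apply.
  - by rewrite p0 hnorm_sqr.
have := sc_form_bound (p v) (fun s => dotcv v (hessian_deriv (x + s *: r) r *m v))
  k sigma _ (dform v).
rewrite sigma0 sigma1 p0 => /(_ isT); apply=> // u /Dt Du.
- exact: hform_ge0.
- exact: sc_ineq.
Qed.

Lemma hnorm_enorm z v : D z -> hnorm z v = enorm (sqrtmx (hessian f z) *m v).
Proof.
move=> Dz; have [[Ssym _] SS] := sqrtmxP _ (sc_posdef z Dz).
apply/eqP; rewrite -(@eqrXn2 _ 2) ?enorm_ge0 ?sqrtr_ge0 // hnorm_sqr // enorm_sqr.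
by rewrite dotcv_mull Ssym mulmxA SS.
Qed.

Lemma hnormD z v w : D z -> hnorm z (v + w) <= hnorm z v + hnorm z w.
Proof. by move=> Dz; rewrite !hnorm_enorm // mulmxDr ler_enormD. Qed.

Lemma hnormZ z c v : D z -> hnorm z (c *: v) = `|c| * hnorm z v.
Proof. by move=> Dz; rewrite !hnorm_enorm // -scalemxAr enormZ. Qed.

(** [invmx S] transports the dual of the local norm to the Euclidean norm. *)
Lemma enorm_dual z w c : D z -> 0 <= c ->
  (forall v, dotcv v w <= hnorm z v * c) ->
  enorm (invmx (sqrtmx (hessian f z)) *m w) <= c.
Proof.
move=> Dz c0 wc; have [Spd SS] := sqrtmxP _ (sc_posdef z Dz).
have Su := posdefmx_unit _ Spd; case: Spd => Ssym _.
set T := invmx _; have Tsym : T^T = T by rewrite /T trmx_inv Ssym.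
apply: enorm_le_dotcv => //; have := wc (T *m (T *m w)).
by rewrite dotcv_mull Tsym hnorm_enorm // mulKVmx.
Qed.

(** Two different vectors are needed because the derivative of [v . grad f] in
    the direction [w] pairs the Hessian with [v] and [w]. *)
Lemma sc_hessian_cross x z t v w : D x -> D z -> hnorm x (z - x) < 1 ->
  0 <= t <= 1 ->
  dotcv v (hessian f (x + t *: (z - x)) *m w) - dotcv v (hessian f x *m w)
  <= ((1 - t * hnorm x (z - x)) ^- 2 - 1) * (hnorm x v * hnorm x w).
Proof.
move=> Dx Dz s1 t01; have Dt := segment_dom x z t Dx Dz t01.
have s0 : 0 <= hnorm x (z - x) by apply: sqrtr_ge0.
have a0 : 0 < 1 - t * hnorm x (z - x).
  have /andP[t0 t1] := t01; have := ler_wpM2r s0 t1; lra.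
have a1 : 1 - t * hnorm x (z - x) <= 1.
  by rewrite lerBlDr lerDl mulr_ge0 //; case/andP: t01.
apply: form_comparison; [exact: sc_posdef|exact: sc_posdef| |].
  by rewrite exprn_gt0 // exprn_ile1 // ltW.
by move=> u; apply: sc_hessian_segment.
Qed.

(** The relative Hessian increment is at most [(1 - t sigma)^-2 - 1], which times
    [sigma] has the primitive [1 / (1 - t sigma) - t sigma]. *)
Lemma sc_gradient_bound x z : D x -> D z -> hnorm x (z - x) < 1 ->
  enorm (invmx (sqrtmx (hessian f x)) *m
         (gradient f z - gradient f x - hessian f x *m (z - x)))
  <= hnorm x (z - x) ^+ 2 / (1 - hnorm x (z - x)).
Proof.
move=> Dx Dz; set sigma := hnorm x (z - x) => s1.
have s0 : 0 <= sigma by apply: sqrtr_ge0.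
have s10 : 0 < 1 - sigma by lra.
apply: enorm_dual => // [|v]; first by rewrite divr_ge0 ?sqr_ge0 // ltW.
set r := z - x; pose nv := hnorm x v; pose c := dotcv v (hessian f x *m r).
pose a (u : R) := 1 + u * - sigma.
have aE (u : R) : a u = 1 - u * sigma by rewrite /a mulrN.
have a0 (u : R) : 0 <= u <= 1 -> a u != 0.
  move=> /andP[u0 u1]; rewrite aE lt0r_neq0 //.
  have := ler_wpM2r s0 u1; lra.
have dG (u : R) : 0 <= u <= 1 ->
    is_derive u 1 (fun u => (0 + u * (c - nv * sigma)) - (- nv) * (a u)^-1)
      ((c - nv * sigma) - (- nv) * (- (a u) ^- 2 * - sigma)).
  move=> u01; apply: is_derive_sub; first exact: is_derive_affine.
  apply: is_derive_scale.
  by apply: (@is_deriveV _ a u); [exact: a0|exact: is_derive_affine].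
have := le_increment (fun u => dotcv v (gradient f (x + u *: r))) _
  (fun u => dotcv v (hessian f (x + u *: r) *m r)) _ 1 ler01
  (fun u u01 => is_derive_gradient_line v x r u (segment_dom x z u Dx Dz u01)) dG.
have F_le (u : R) : 0 <= u <= 1 -> dotcv v (hessian f (x + u *: r) *m r)
    <= (c - nv * sigma) - (- nv) * (- (a u) ^- 2 * - sigma).
  move=> u01.
  have : dotcv v (hessian f (x + u *: r) *m r) - c <= (a u ^- 2 - 1) * (nv * sigma).
    by rewrite aE; apply: sc_hessian_cross.
  move: (dotcv v _) (c) (nv) (sigma) (a u ^- 2) => ? ? ? ? ?; lra.
move=> /(_ F_le); rewrite scale1r scale0r addr0.
have -> : x + r = z by rewrite /r addrC subrK.
have -> : dotcv v (gradient f z - gradient f x - hessian f x *m r)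
   = dotcv v (gradient f z) - dotcv v (gradient f x) - c by rewrite !dotcvBr.
have a_0 : a 0 = 1 by rewrite aE mul0r subr0.
have a_1 : a 1 = 1 - sigma by rewrite aE mul1r.
rewrite a_0 a_1 invr1 -/nv.
have -> : nv * (sigma ^+ 2 / (1 - sigma)) = nv * ((1 - sigma)^-1 - 1 - sigma).
  by field; exact: lt0r_neq0.
move: (dotcv v _) (dotcv v _) (c) (nv) (sigma) (1 - sigma)^-1.
move=> ? ? ? ? ? ?; lra.
Qed.

(** Balls of the local norm are convex, so that the whole segment stays at
    distance [m] of [x], where the Hessian increment is at most
    [(1 - m)^-2 - 1 <= 6 m]. *)
Lemma sc_gradient_diff_bound x z1 z2 m : D x -> D z1 -> D z2 ->
  m <= 1 / 12 -> hnorm x (z1 - x) <= m -> hnorm x (z2 - x) <= m ->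
  enorm (invmx (sqrtmx (hessian f x)) *m
         (gradient f z2 - gradient f z1 - hessian f x *m (z2 - z1)))
  <= 6 * m * hnorm x (z2 - z1).
Proof.
move=> Dx D1 D2 m12 z1m z2m.
have m0 : 0 <= m by apply: le_trans z1m; apply: sqrtr_ge0.
apply: enorm_dual => // [|v]; first by rewrite !mulr_ge0 // sqrtr_ge0.
set s := z2 - z1.
set c := dotcv v (hessian f x *m s) + 6 * m * (hnorm x v * hnorm x s).
have Ds (u : R) : 0 <= u <= 1 -> D (z1 + u *: s) by apply: segment_dom.
have um (u : R) : 0 <= u <= 1 -> hnorm x (z1 + u *: s - x) <= m.
  move=> /andP[u0 u1].
  have -> : z1 + u *: s - x = (1 - u) *: (z1 - x) + u *: (z2 - x).
    by rewrite /s; apply/matrixP => i j; rewrite !mxE; ring.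
  apply: le_trans (hnormD _ _ _ Dx) _; rewrite !hnormZ // !ger0_norm ?subr_ge0 //.
  have u1' : 0 <= 1 - u by rewrite subr_ge0.
  have := ler_wpM2l u0 z2m; have := ler_wpM2l u1' z1m; lra.
have F_le (u : R) : 0 <= u <= 1 -> dotcv v (hessian f (z1 + u *: s) *m s) <= c.
  move=> u01; have hm := um u u01; have y1 : hnorm x (z1 + u *: s - x) < 1.
    by apply: le_lt_trans hm _; lra.
  have h01 : 0 <= (1 : R) <= 1 by rewrite ler01 lexx.
  have := sc_hessian_cross x _ 1 v s Dx (Ds u u01) y1 h01.
  rewrite mul1r scale1r (addrC x) subrK /c -lerBlDl => /le_trans; apply.
  rewrite ler_wpM2r ?mulr_ge0 ?sqrtr_ge0 //.
  move: hm y1; set t := hnorm _ _ => tm t1; have t0 : 0 <= t by apply: sqrtr_ge0.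
  apply: le_trans (_ : 6 * t <= _); last by lra.
  rewrite lerBlDr -[X in X <= _]mul1r ler_pdivrMr ?exprn_gt0 ?subr_gt0 //.
  rewrite -subr_ge0 (_ : _ - _ = t * (4 - 11 * t + 6 * t ^+ 2)); last by ring.
  by rewrite mulr_ge0 //; have := sqr_ge0 t; lra.
have := le_increment (fun u => dotcv v (gradient f (z1 + u *: s)))
  (fun u => 0 + u * c) _ (fun=> c) 1 ler01
  (fun u u01 => is_derive_gradient_line v z1 s u (Ds u u01))
  (fun u _ => is_derive_affine 0 c u) F_le.
rewrite scale1r scale0r addr0 {1}/s (addrC z1) subrK !dotcvBr /c; lra.
Qed.

Hypothesis D_open : open D.

Lemma gradient_at_min x : D x -> (forall z, D z -> f x <= f z) -> gradient f x = 0.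
Proof.
move=> Dx xmin; apply/matrixP => i j; rewrite !mxE; set v := delta_mx i 0.
have line_cont : {for 0, continuous (fun t : R => x + t *: v)}.
  by apply: continuousD; [exact: cst_continuous|exact: scalel_continuous].
have : \forall t \near (0 : R), D (x + t *: v).
  by apply: line_cont; apply: open_nbhs_nbhs; split => //=; rewrite scale0r addr0.
move=> /nbhs_ballP[e /= e0 De].
have De' (t : R) : t \in `]- e, e[%R -> D (x + t *: v).
  rewrite in_itv /= => /andP[et te]; apply: De.
  by rewrite /ball /= sub0r normrN ltr_norml et te.
have dline (t : R) : D (x + t *: v) ->
    is_derive t 1 (fun u => f (x + u *: v)) ('D_v f (x + t *: v)).
  by move=> Dt; apply: is_derive_line; apply: sc_diff1.
have i0 : 0 \in `]- e, e[%R by rewrite in_itv /= oppr_lt0 e0.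
have := @derive1_at_min R (fun u => f (x + u *: v)) (- e) e 0.
case=> [|t /De'/dline dt|//|t /De' Dt|_ d0].
- by rewrite ge0_cp // ltW.
- exact: (@ex_derive _ _ _ _ _ _ _ dt).
- by rewrite scale0r addr0; apply: xmin.
have := @derive_val _ _ _ _ _ _ _ (dline 0 (De' 0 i0)).
by rewrite d0 scale0r addr0.
Qed.

(** The second derivative along the segment lies between constants; integrating
    twice leaves no first-order term at a critical point. *)
Lemma sc_value_bounds x z : D x -> D z -> gradient f x = 0 ->
  hnorm x (z - x) < 1 ->
  (1 - hnorm x (z - x)) ^+ 2 * hnorm x (z - x) ^+ 2 / 2 <= f z - f x
  <= hnorm x (z - x) ^+ 2 / (1 - hnorm x (z - x)) ^+ 2 / 2.
Proof.
move=> Dx Dz gx0; set sigma := hnorm x (z - x); set r := z - x => s1.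
have s0 : 0 <= sigma by apply: sqrtr_ge0.
have sigma2 : sigma ^+ 2 = dotcv r (hessian f x *m r) by apply: hnorm_sqr.
have seg (u : R) : 0 <= u <= 1 -> (1 - u * sigma) ^+ 2 * sigma ^+ 2
    <= dotcv r (hessian f (x + u *: r) *m r) <= sigma ^+ 2 / (1 - u * sigma) ^+ 2.
  by move=> u01; rewrite sigma2; apply: sc_hessian_segment.
clearbody sigma.
have Dt (u : R) : 0 <= u <= 1 -> D (x + u *: r) by apply: segment_dom.
pose th (u : R) := dotcv r (gradient f (x + u *: r)).
have df (u : R) : 0 <= u <= 1 -> is_derive u 1 (fun u => f (x + u *: r)) (th u).
  move=> /Dt Du; have := is_derive_line f x r u (sc_diff1 _ Du).
  by rewrite derive_gradient // dotcvC.
have dth (u : R) : 0 <= u <= 1 ->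
    is_derive u 1 th (dotcv r (hessian f (x + u *: r) *m r)).
  by move=> /Dt; apply: is_derive_gradient_line.
have th0 : th 0 = 0 by rewrite /th scale0r addr0 gx0 dotcv0r.
have quad (c u : R) : is_derive u 1 (fun u => c / 2 * (u * u)) (u * c).
  have dd := is_derive_mul id id u 1 1 (is_derive_id u 1) (is_derive_id u 1).
  have := is_derive_scale (c / 2) _ _ u dd.
  by congr is_derive; rewrite /=; field.
have form (u : R) : 0 <= u <= 1 ->
    (1 - sigma) ^+ 2 * sigma ^+ 2 <= dotcv r (hessian f (x + u *: r) *m r)
    <= sigma ^+ 2 / (1 - sigma) ^+ 2.
  move=> u01; have /andP[lo up] := seg u u01.
  have us : u * sigma <= sigma by rewrite ler_piMl //; case/andP: u01.
  have ss : (1 - sigma) ^+ 2 <= (1 - u * sigma) ^+ 2.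
    have s10 : 0 <= 1 - sigma by rewrite subr_ge0 ltW.
    have s1u : 1 - sigma <= 1 - u * sigma by rewrite lerD2l lerN2.
    by apply: lerXn2r; rewrite // nnegrE (le_trans s10).
  have s2 : 0 < (1 - sigma) ^+ 2 by rewrite exprn_gt0 // subr_gt0.
  apply/andP; split.
    by apply: le_trans lo; rewrite ler_wpM2r ?sqr_ge0.
  apply: le_trans up _; rewrite ler_wpM2l ?sqr_ge0 // lef_pV2 ?posrE //.
  exact: lt_le_trans ss.
have sub (u s : R) : 0 <= u <= 1 -> 0 <= s <= u -> 0 <= s <= 1.
  by move=> /andP[_ u1] /andP[-> su]; apply: le_trans su u1.
set c1 := (1 - sigma) ^+ 2 * sigma ^+ 2 in form *.
set c2 := sigma ^+ 2 / (1 - sigma) ^+ 2 in form *.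
have th_lo (u : R) : 0 <= u <= 1 -> u * c1 <= th u.
  move=> u01; have u0 : 0 <= u by case/andP: u01.
  have := le_increment (fun s => 0 + s * c1) th (fun=> c1) _ u u0
    (fun s _ => is_derive_affine 0 c1 s) (fun s su => dth s (sub u s u01 su)).
  rewrite th0 mul0r !add0r !subr0; apply=> s su.
  by have /andP[] := form s (sub u s u01 su).
have th_up (u : R) : 0 <= u <= 1 -> th u <= u * c2.
  move=> u01; have u0 : 0 <= u by case/andP: u01.
  have := le_increment th (fun s => 0 + s * c2) _ (fun=> c2) u u0
    (fun s su => dth s (sub u s u01 su)) (fun s _ => is_derive_affine 0 c2 s).
  rewrite th0 mul0r !add0r !subr0; apply=> s su.
  by have /andP[] := form s (sub u s u01 su).
have lo := le_increment _ _ _ _ 1 ler01 (fun u _ => quad c1 u) df th_lo.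
have up := le_increment _ _ _ _ 1 ler01 df (fun u _ => quad c2 u) th_up.
have xr : x + r = z by rewrite /r addrC subrK.
move: lo up; rewrite scale1r scale0r addr0 xr !mulr1 !mulr0 !subr0.
by rewrite /c1 /c2 => -> ->.
Qed.

End Segment.

(** * The constants of the rate *)

Section FinalBounds.
Context {R : realType} {d : nat}.

(** By cyclicity of the trace, the squared norm is [tr (S^2 E S^2 E^T)].  Hence all
    symmetric square roots of the inverse Hessian give the same norm. *)
Lemma fnorm_scaling (S T E : 'M[R]_d) : S^T = S -> T^T = T -> S *m S = T *m T ->
  fnorm (S *m E *m S) = fnorm (T *m E *m T).
Proof.
move=> Ssym Tsym ST.
have trE (A : 'M[R]_d) : fnorm A ^+ 2 = \tr (A *m A^T).
  rewrite fnorm_sqr; apply: eq_bigr => i _; rewrite mxE.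
  by apply: eq_bigr => j _; rewrite mxE.
have scaled (U : 'M[R]_d) : U^T = U ->
    fnorm (U *m E *m U) ^+ 2 = \tr ((U *m U) *m E *m (U *m U) *m E^T).
  by move=> Usym; rewrite trE !trmx_mul Usym !mulmxA mxtrace_mulC !mulmxA.
apply/eqP; rewrite -(@eqrXn2 _ 2) ?fnorm_ge0 //.
by rewrite !scaled // ST.
Qed.

Lemma mx_norm_le_enorm (v : 'cV[R]_d) : `|v| <= enorm v.
Proof.
rewrite /Num.Def.normr /= mx_normrE.
apply: Order.POrderTheory.bigmax_le; first exact: enorm_ge0.
move=> [i j] _ /=; rewrite (ord1 j) -[leRHS]ger0_norm ?enorm_ge0 //.
rewrite -ler_sqr ?nnegrE // !real_normK ?num_real // enorm_sqr dotcvE.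
by rewrite (bigD1 i) //= expr2 lerDl sumr_ge0 // => k _; rewrite -expr2 sqr_ge0.
Qed.

Lemma geometric_cvg (S T : 'M[R]_d) (x : nat -> 'cV[R]_d) (xs : 'cV[R]_d) (rho c : R) :
  0 <= rho < 1 -> T *m S = 1%:M ->
  (forall k, enorm (S *m (x k - xs)) <= rho ^+ k * c) -> x @ \oo --> xs.
Proof.
move=> /andP[rho0 rho1] TS xk.
have c0 : 0 <= c by have := xk 0%N; rewrite expr0 mul1r; apply/le_trans/enorm_ge0.
have bound k : `|xs - x k| <= fnorm T * c * rho ^+ k.
  rewrite distrC; apply: le_trans (mx_norm_le_enorm _) _.
  rewrite -[x k - xs]mul1mx -TS -mulmxA; apply: le_trans (enorm_mulmx_le _ _) _.
  by rewrite -mulrA ler_wpM2l ?fnorm_ge0 // mulrC.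
have lim0 : (fun k => fnorm T * c * rho ^+ k) @ \oo --> (0 : R).
  rewrite -[X in _ --> X](mulr0 (fnorm T * c)); apply: cvgMr => //.
  by apply: cvg_expr; rewrite ger0_norm.
apply/cvgrPdist_le => e e0; move/cvgrPdist_le : lim0 => /(_ e e0).
apply: filterS => k; rewrite sub0r normrN => /(le_trans (ler_norm _)).
exact: le_trans.
Qed.

Lemma quadratic_remainder_le (s : R) : 0 <= s <= 1 / 12 -> s ^+ 2 / (1 - s) <= 2 * s ^+ 2.
Proof.
move=> /andP[s0 s12]; have s1 : 0 < 1 - s by lra.
rewrite ler_pdivrMr // mulrAC mulrC ler_peMr ?sqr_ge0 //; lra.
Qed.

(** The Taylor estimates lose a factor [(1 - s0)^(-4)], which is at most
    [(1 + eps / 3)^4] since [s0 <= eps / 6].  Two of these four factors are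
    explicit in the conclusion; the other two come from replacing [m] by [rate],
    which gains [(1 + eps / 3)^(2 k)]. *)
Lemma value_ratio (eps s0 sk m rate fk f0 : R) (k : nat) : (1 <= k)%N ->
  0 < eps < 1 / 2 -> 0 < s0 -> s0 <= eps / 6 -> 0 <= sk -> sk <= s0 -> 0 <= m ->
  sk <= m ^+ k * s0 -> (1 + eps / 3) * m <= rate ->
  fk <= sk ^+ 2 / (1 - sk) ^+ 2 / 2 -> (1 - s0) ^+ 2 * s0 ^+ 2 / 2 <= f0 ->
  fk / f0 <= (1 + eps / 3) ^+ 2 * rate ^+ (2 * k).
Proof.
move=> k1 /andP[eps0 eps12] s0_gt0 s0_le sk0 sks0 m0 skm m_rate fk_le f0_ge.
set a := 1 + eps / 3 in m_rate *.
have a1 : 1 <= a by rewrite /a; lra.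
have s01 : 0 < 1 - s0 by lra.
have sk1 : 0 < 1 - sk by lra.
have f0_gt0 : 0 < f0.
  by apply: lt_le_trans f0_ge; rewrite !mulr_gt0 ?exprn_gt0 ?invr_gt0.
rewrite ler_pdivrMr //; apply: le_trans fk_le _.
have as0 : 1 <= a * (1 - s0).
  have h : eps * s0 <= eps * (eps / 6) by rewrite ler_wpM2l // ltW.
  have h' : eps * eps <= eps * (1 / 2) by rewrite ler_wpM2l // ltW.
  rewrite /a; lra.
have a0 : 0 <= a by lra.
have rate_ge : a ^+ 2 * m ^+ (2 * k) <= rate ^+ (2 * k).
  apply: le_trans (_ : (a * m) ^+ (2 * k) <= _).
    by rewrite exprMn ler_wpM2r ?exprn_ge0 // ler_weXn2l // leq_pmulr.
  apply: lerXn2r => //; rewrite nnegrE ?mulr_ge0 //.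
  by apply: le_trans m_rate; rewrite mulr_ge0.
have sk2 : sk ^+ 2 <= m ^+ (2 * k) * s0 ^+ 2.
  rewrite mulnC exprM -exprMn.
  apply: lerXn2r; rewrite // nnegrE ?mulr_ge0 ?exprn_ge0 //; lra.
have inv_le : (1 - sk) ^- 2 <= a ^+ 4 * (1 - s0) ^+ 2.
  apply: le_trans (_ : (1 - s0) ^- 2 <= _).
    by rewrite lef_pV2 ?posrE ?exprn_gt0 //; apply: lerXn2r; rewrite ?nnegrE; lra.
  rewrite -[leLHS]mul1r ler_pdivrMr ?exprn_gt0 //.
  have -> : a ^+ 4 * (1 - s0) ^+ 2 * (1 - s0) ^+ 2 = (a * (1 - s0)) ^+ 4 by ring.
  exact: exprn_ege1.
apply: le_trans (_ : m ^+ (2 * k) * s0 ^+ 2 * (a ^+ 4 * (1 - s0) ^+ 2) / 2 <= _).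
  rewrite ler_pM2r ?invr_gt0 // ler_pM ?sqr_ge0 ?invr_ge0 ?exprn_ge0 ?(ltW sk1) //.
apply: le_trans (_ : a ^+ 2 * rate ^+ (2 * k) * ((1 - s0) ^+ 2 * s0 ^+ 2 / 2) <= _).
  have -> : m ^+ (2 * k) * s0 ^+ 2 * (a ^+ 4 * (1 - s0) ^+ 2) / 2
    = a ^+ 2 * (a ^+ 2 * m ^+ (2 * k)) * ((1 - s0) ^+ 2 * s0 ^+ 2 / 2) by ring.
  have X0 : 0 <= (1 - s0) ^+ 2 * s0 ^+ 2 / 2 by rewrite divr_ge0 // mulr_ge0 // sqr_ge0.
  by rewrite ler_wpM2r // ler_wpM2l ?sqr_ge0.
rewrite ler_wpM2l // mulr_ge0 ?sqr_ge0 //.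
by apply: le_trans rate_ge; rewrite mulr_ge0 ?sqr_ge0 ?exprn_ge0.
Qed.

Lemma weight_itv (phi delta : R) : 0 <= phi <= 1 -> 0 < delta < 1 / 2 ->
  let kappa := (1 - 2 * delta) / (1 + 2 * delta) in
  [/\ 0 < kappa, kappa <= phi + (1 - phi) * kappa & phi + (1 - phi) * kappa <= 1].
Proof.
move=> /andP[phi0 phi1] /andP[delta0 delta12] kappa; rewrite /kappa {kappa}.
have k0 : 0 < (1 - 2 * delta) / (1 + 2 * delta) by rewrite divr_gt0; lra.
have k1 : (1 - 2 * delta) / (1 + 2 * delta) <= 1 by rewrite ler_pdivrMr; lra.
set k := _ / _ in k0 k1 *.
have h1 : phi * k <= phi * 1 by rewrite ler_wpM2l.
have phi1' : 0 <= 1 - phi by lra.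
have h2 : (1 - phi) * k <= (1 - phi) * 1 by rewrite ler_wpM2l.
by split; [exact: k0| lra | lra].
Qed.

Lemma weight_sup_bounds (phi : nat -> R) (delta : R)
  (q := sup (range (fun k =>
    Num.sqrt (1 / (phi k + (1 - phi k) * ((1 - 2 * delta) / (1 + 2 * delta))))))) :
  (forall k, 0 <= phi k <= 1) -> 0 < delta < 1 / 2 ->
  1 <= q <= Num.sqrt ((1 + 2 * delta) / (1 - 2 * delta)) /\
  forall k, 1 <= q ^+ 2 * (phi k + (1 - phi k) * ((1 - 2 * delta) / (1 + 2 * delta))).
Proof.
move=> phi01 deltaP.
pose w k := phi k + (1 - phi k) * ((1 - 2 * delta) / (1 + 2 * delta)).
have wP k := weight_itv _ _ (phi01 k) deltaP.
have w0 k : 0 < w k by have [k0 kw _] := wP k; apply: lt_le_trans kw.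
have w_up k : Num.sqrt (1 / w k) <= Num.sqrt ((1 + 2 * delta) / (1 - 2 * delta)).
  have [k0 kw _] := wP k; rewrite ler_wsqrtr // div1r -invf_div.
  by rewrite lef_pV2 ?posrE.
have ubd : has_ubound (range (fun k => Num.sqrt (1 / w k))).
  by exists (Num.sqrt ((1 + 2 * delta) / (1 - 2 * delta))) => _ [k _ <-].
have q_ge k : Num.sqrt (1 / w k) <= q by apply: ub_le_sup => //; exists k.
have one_le k : 1 <= Num.sqrt (1 / w k).
  rewrite -[leLHS]sqrtr1 ler_wsqrtr // div1r invr_ge1 ?unitf_gt0 ?unitfE ?lt0r_neq0 //.
  by have [] := wP k.
have q1 : 1 <= q by apply: le_trans (one_le 0%N) (q_ge 0%N).
split; first rewrite q1 /=.
  apply: ge_sup; first by exists (Num.sqrt (1 / w 0%N)), 0%N.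
  by move=> _ [k _ <-]; apply: w_up.
move=> k; rewrite -/(w k) -ler_pdivrMr ?w0 //.
have wV : 0 <= 1 / w k by rewrite divr_ge0 // ltW.
rewrite -[leLHS]sqr_sqrtr //; apply: lerXn2r; rewrite ?nnegrE ?sqrtr_ge0 //.
exact: le_trans q1.
Qed.

Lemma perturbation_coef_le_sup (phi : nat -> R) (eps delta : R) (k : nat) :
  (forall k, 0 <= phi k <= 1) -> 0 < eps < 1 / 2 -> 0 < delta < 1 / 2 ->
  phi k * (2 * delta + 1) * (4 / (1 - eps) ^+ 2) + (3 + eps) / (1 - eps)
  <= sup (range (fun k => phi k * (2 * delta + 1) * (4 / (1 - eps) ^+ 2)
                          + (3 + eps) / (1 - eps))).
Proof.
move=> phi01 /andP[eps0 eps12] /andP[delta0 delta12].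
apply: ub_le_sup; last by exists k.
exists (1 * (2 * delta + 1) * (4 / (1 - eps) ^+ 2) + (3 + eps) / (1 - eps)).
move=> _ [j _ <-]; rewrite lerD2r ler_wpM2r ?divr_ge0 ?sqr_ge0 //.
by rewrite ler_wpM2r //; [lra|case/andP: (phi01 j)].
Qed.

Lemma mean_factor_ge0 (eps delta rho q n : R) :
  0 < eps -> 0 < delta -> 0 < rho -> rho < 1 -> 0 <= q -> 0 <= n ->
  0 <= (2 * Num.sqrt 2 * delta * (1 + rho) * q * Num.sqrt n
        + eps / (3 * (1 - rho))) / n.
Proof.
move=> eps0 delta0 rho0 rho1 q0 n0; rewrite divr_ge0 // addr_ge0 //.
  by rewrite !mulr_ge0 ?sqrtr_ge0 ?addr_ge0 // ltW.
by rewrite divr_ge0 ?mulr_ge0 ?subr_ge0 // ltW.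
Qed.

Lemma mean_factor_le_rate (eps delta rho q n : R) :
  0 < eps -> 0 < delta -> 0 < rho -> rho < 1 -> 0 <= q -> 0 <= n ->
  (1 + eps / 3) * ((2 * Num.sqrt 2 * delta * (1 + rho) * q * Num.sqrt n
                    + eps / (3 * (1 - rho))) / n)
  <= (2 * Num.sqrt 2 * delta * (1 + rho) * (1 + eps / 3) * q * Num.sqrt n
      + (1 + rho) * (1 + eps / 3) * eps / (3 * (1 - rho))) / n.
Proof.
move=> eps0 delta0 rho0 rho1 q0 n0; rewrite mulrA ler_wpM2r ?invr_ge0 //.
rewrite mulrDr; apply: lerD.
  by rewrite le_eqVlt; apply/orP; left; apply/eqP; ring.
rewrite -!mulrA ler_peMl //; last by rewrite lerDl ltW.
by rewrite mulr_ge0 ?addr_ge0 ?divr_ge0 ?mulr_ge0 ?subr_ge0 // ltW.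
Qed.

End FinalBounds.

(** * Superlinear convergence *)

Theorem theorem5p4 (R : realType) (d : nat)
  (D : set 'cV[R]_d) (f : 'cV[R]_d -> R) (xs : 'cV[R]_d)
  (phi : nat -> R) (x : nat -> 'cV[R]_d) (B : nat -> 'M[R]_d)
  (eps delta rho : R)
  (D_open : open D) (D_convex : convex_set D) (f_convex : convex_function D f)
  (f_sc : self_concordant D f) (xs_min : unique_minimizer D f xs)
  (phi01 : forall k, 0 <= phi k <= 1)
  (x_iter : broyden_iterates D f phi x B)
  (x_neq : forall k, x k.+1 - x k != 0)
  (x0_near : enorm (sqrtmx (hessian f xs) *m (x 0%N - xs)) <= eps / 6)
  (B0_near : fnorm (sqrtmx (invmx (hessian f xs)) *m (B 0%N - hessian f xs)
                      *m sqrtmx (invmx (hessian f xs))) <= delta)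
  (eps_itv : 0 < eps < 1 / 2) (delta_itv : 0 < delta < 1 / 2)
  (rho_itv : 0 < rho < 1)
  (cond1 : sup (range (fun k => phi k * (2 * delta + 1) * (4 / (1 - eps) ^+ 2)
                                + (3 + eps) / (1 - eps)))
           * (eps / (1 - rho)) <= delta)
  (cond2 : eps / 3 + 2 * delta <= (1 - 2 * delta) * rho) :
  let q := sup (range (fun k =>
    Num.sqrt (1 / (phi k + (1 - phi k) * ((1 - 2 * delta) / (1 + 2 * delta)))))) in
  let rate := fun k : nat =>
    (2 * Num.sqrt 2 * delta * (1 + rho) * (1 + eps / 3) * q * Num.sqrt k%:R
     + (1 + rho) * (1 + eps / 3) * eps / (3 * (1 - rho))) / k%:R in
  [/\ x @ \oo --> xs,
      forall k : nat, (1 <= k)%N ->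
        enorm (sqrtmx (hessian f xs) *m (x k - xs))
        / enorm (sqrtmx (hessian f xs) *m (x 0%N - xs)) <= rate k ^+ k,
      forall k : nat, (1 <= k)%N ->
        (f (x k) - f xs) / (f (x 0%N) - f xs)
        <= (1 + eps / 3) ^+ 2 * rate k ^+ (2 * k) &
      1 <= q <= Num.sqrt ((1 + 2 * delta) / (1 - 2 * delta))].
Proof.
have Dxs : D xs := xs_min.1.
have fmin z : D z -> f xs <= f z.
  by move=> Dz; have [->//|/(xs_min.2 z Dz)/ltW] := eqVneq z xs.
have gxs : gradient f xs = 0 by apply: (gradient_at_min D f f_sc D_open).
have Hpd : posdefmx (hessian f xs) by apply: (sc_posdef D f f_sc).
have Hu := posdefmx_unit _ Hpd.
have [Spd SS] := sqrtmxP _ Hpd; have [S'pd S'S'] := sqrtmxP _ (posdefmx_inv _ Hpd).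
have Su := posdefmx_unit _ Spd.
set S := sqrtmx (hessian f xs) in Spd SS Su x0_near *.
set S' := sqrtmx (invmx _) in S'pd S'S' B0_near.
have [Ssym _] := Spd; have [S'sym _] := S'pd.
pose T := invmx S; have Tsym : T^T = T by rewrite /T trmx_inv Ssym.
have TS : T *m S = 1%:M by rewrite /T mulVmx.
have ST : S *m T = 1%:M by rewrite /T mulmxV.
have TT : T *m T = invmx (hessian f xs).
  apply: (can_inj (mulmxK Hu)); rewrite mulVmx // -[X in _ *m X]SS.
  by rewrite -mulmxA (mulmxA T S) TS mul1mx.
pose r k := S *m (x k - xs); pose g k := T *m gradient f (x k).
pose Bh k := T *m B k *m T.
have [B0pd Dx x_step B_step] := x_iter.
have rdiff k : r k.+1 - r k = S *m (x k.+1 - x k).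
  by rewrite -mulmxBr; congr (_ *m _); rewrite opprB addrA subrK.
have hnormE z : hnorm f xs (z - xs) = enorm (S *m (z - xs)).
  exact: (hnorm_enorm D f f_sc).
have hr k : hnorm f xs (x k - xs) = enorm (r k) by apply: hnormE.
have THz w : T *m (hessian f xs *m w) = S *m w.
  by rewrite -SS -(mulmxA S) (mulmxA T) TS mul1mx.
have r_step k : Bh k \in unitmx -> r k.+1 = r k - invmx (Bh k) *m g k.
  move=> Bhu.
  have Bu : B k \in unitmx by move: Bhu; rewrite !unitmx_mul => /andP[/andP[]].
  rewrite /r x_step.
  have -> : invmx (Bh k) *m g k = S *m (invmx (B k) *m gradient f (x k)).
    apply: (can_inj (mulKmx Bhu)); rewrite mulKVmx //.
    rewrite /Bh -!mulmxA (mulmxA T S) TS mul1mx (mulmxA (B k)) mulmxV //.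
    by rewrite mul1mx.
  by rewrite -mulmxBr; congr (_ *m _); rewrite addrAC.
have Bh_step k : Bh k.+1 =
    broyden_update (phi k) (Bh k) (r k.+1 - r k) (g k.+1 - g k).
  rewrite rdiff /g -mulmxBr /Bh B_step.
  by rewrite broyden_update_congr.
have r_neq k : r k.+1 - r k != 0.
  rewrite rdiff; apply: contra_neq (x_neq k) => Sx.
  by rewrite -[LHS]mul1mx -TS -mulmxA Sx mulmx0.
have g_near k : enorm (r k) <= 1 / 12 ->
    enorm (g k - r k) <= 2 * enorm (r k) ^+ 2.
  move=> rk; have rk1 : enorm (r k) < 1 by apply: le_lt_trans rk _; lra.
  have := sc_gradient_bound D f D_convex f_sc xs (x k) Dxs (Dx k).
  rewrite hr gxs subr0 -/S mulmxBr -/T THz => /(_ rk1) /le_trans; apply.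
  by apply: quadratic_remainder_le; rewrite enorm_ge0.
have y_near k : enorm (r k) <= 1 / 12 -> enorm (r k.+1) <= enorm (r k) ->
    enorm ((g k.+1 - g k) - (r k.+1 - r k))
    <= 6 * enorm (r k) * enorm (r k.+1 - r k).
  have hs : hnorm f xs (x k.+1 - x k) = enorm (S *m (x k.+1 - x k)).
    exact: (hnorm_enorm D f f_sc).
  move=> rk rk1; rewrite rdiff -hs /g -mulmxBr -THz -mulmxBr.
  apply: (sc_gradient_diff_bound D f D_convex f_sc) => //; by rewrite hr.
have [eps0 eps12] := andP eps_itv; have [delta0 delta12] := andP delta_itv.
have [rho0 rho1] := andP rho_itv.
set W := sup _ in cond1.
have W_ge k := perturbation_coef_le_sup phi eps delta k phi01 eps_itv delta_itv.
have [q_itv q_ge] := weight_sup_bounds phi delta phi01 delta_itv.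
set q0 := sup _ in q_itv q_ge.
have q_ge0 : 0 <= q0 by have /andP[q1 _] := q_itv; apply: le_trans q1.
have Bh0_sym : (Bh 0%N)^T = Bh 0%N.
  by rewrite /Bh !trmx_mul Tsym B0pd.1 mulmxA.
have Bh0_near : fnorm (Bh 0%N - 1%:M) <= delta.
  (* The square roots [S'] of [H^-1] and [T] enter only through their squares. *)
  have -> : Bh 0%N - 1%:M = T *m (B 0%N - hessian f xs) *m T.
    have THT : T *m hessian f xs *m T = 1%:M.
      by rewrite -[X in _ *m X *m _]SS (mulmxA T) TS mul1mx ST.
    by rewrite mulmxBr mulmxBl THT.
  by rewrite -(fnorm_scaling S' T) // S'S'.
have lin := linear_rate r g Bh phi eps delta rho W r_step Bh_step r_neq g_near
  y_near phi01 eps0 eps12 delta0 delta12 rho0 rho1 W_ge cond1 cond2 Bh0_sym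
  Bh0_near x0_near.
have sup_lin := superlinear_rate r g Bh phi eps delta rho W q0 r_step Bh_step r_neq
  g_near y_near phi01 eps0 eps12 delta0 delta12 rho0 rho1 W_ge cond1 cond2 q_ge0
  q_ge Bh0_sym Bh0_near x0_near.
(* Otherwise the linear rate would give [x 1 = x 0]. *)
have r0_gt0 : 0 < enorm (r 0%N).
  rewrite enorm_gt0; apply: contra_neq (r_neq 0%N) => r0.
  have := lin 1%N; rewrite r0 enorm0 mulr0 => r1.
  have /eqP -> : r 1%N == 0 by rewrite -enorm_eq0 eq_le r1 enorm_ge0.
  by rewrite subr0.
have r_le k : enorm (r k) <= enorm (r 0%N).
  by apply: le_trans (lin k) _; rewrite ler_piMl ?enorm_ge0 // exprn_ile1 // ltW.
pose mean k : R := (2 * Num.sqrt 2 * delta * (1 + rho) * q0 * Num.sqrt k%:R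
  + eps / (3 * (1 - rho))) / k%:R.
have mean_ge0 k : 0 <= mean k by apply: mean_factor_ge0.
move=> q rate.
have mean_rate k : (1 + eps / 3) * mean k <= rate k by apply: mean_factor_le_rate.
have rate_ge k : mean k <= rate k.
  apply: le_trans (mean_rate k); rewrite ler_peMl // lerDl divr_ge0 //.
  exact: ltW.
split=> //.
- apply: (geometric_cvg S T x xs rho (enorm (r 0%N))) => //.
  by rewrite ltW.
- move=> k _; rewrite ler_pdivrMr //; apply: le_trans (sup_lin k) _.
  rewrite ler_wpM2r ?enorm_ge0 //; apply: lerXn2r; last exact: rate_ge.
    by rewrite nnegrE; apply: mean_ge0.
  by rewrite nnegrE; apply: le_trans (mean_ge0 k) (rate_ge k).
- move=> k k1; have r1 j : hnorm f xs (x j - xs) < 1.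
    by rewrite hr; apply: le_lt_trans (le_trans (r_le j) x0_near) _; lra.
  have value j := sc_value_bounds D f D_convex f_sc xs (x j) Dxs (Dx j) gxs (r1 j).
  have /andP[_ up] := value k; have /andP[lo _] := value 0%N.
  rewrite !hr in up lo.
  by apply: (value_ratio eps (enorm (r 0%N)) (enorm (r k)) (mean k));
     rewrite ?enorm_ge0.
Qed.
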